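(* Let $A$ be a finitely generated solvable Lie algebra over a field. Then each nonsingular equation with one unknown over $A$ has a solution in $A$ if and only if $A$ is nilpotent.
   Context: Let $\langle x\rangle$ be the one-dimensional Lie algebra generated by $x$, and let $A*\langle x\rangle$ be the free product (coproduct) of Lie algebras over the ground field. A nonsingular equation (with one unknown $x$) over a Lie algebra $A$ is an equality of the form $w(x)=0$, where $w(x)$ is an element of $A*\langle x\rangle$ not lying in the ideal of $A*\langle x\rangle$ generated by $A$. A solution in $A$ is an element $a\in A$ such that $w(a)=0$, where $w(a)$ is the image of $w(x)$ under the homomorphism $A*\langle x\rangle\to A$ that is the identity on $A$ and sends $x$ to $a$. *)

(* Defs.v *)
From HB Require Import structures.
From mathcomp Require Import all_boot all_order all_algebra.
From mathcomp Require Import boolp classical_sets.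

Set Implicit Arguments.
Unset Strict Implicit.
Unset Printing Implicit Defensive.

Import GRing.Theory.
Import generic_quotient.
Local Open Scope ring_scope.
Local Open Scope classical_set_scope.
Local Open Scope quotient_scope.

(* The alternating law is [bracketxx], so that characteristic 2 is covered;
   no finiteness of the dimension is assumed. *)
HB.mixin Record Lmodule_isLieAlgebra (K : fieldType) L of GRing.Lmodule K L := {
  bracket : L -> L -> L;
  bracketPl : forall (z : L) (c : K) (x y : L),
    bracket (c *: x + y) z = c *: bracket x z + bracket y z;
  bracketPr : forall (z : L) (c : K) (x y : L),
    bracket z (c *: x + y) = c *: bracket z x + bracket z y;
  bracketxx : forall x : L, bracket x x = 0;
  jacobi : forall x y z : L,
    bracket x (bracket y z) + bracket y (bracket z x)
      + bracket z (bracket x y) = 0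
}.

#[short(type="lieAlgType")]
HB.structure Definition LieAlgebra (K : fieldType) :=
  { L of GRing.Lmodule K L & Lmodule_isLieAlgebra K L }.

Notation "⁅ x , y ⁆" := (bracket x y) (at level 0, x, y at level 99) : ring_scope.

Section BracketScale.
Context {K : fieldType} {L : lieAlgType K}.

Lemma bracket0l (y : L) : ⁅0, y⁆ = 0.
Proof.
by have := bracketPl y (-1) 0 0; rewrite scaler0 addr0 scaleN1r addNr.
Qed.

Lemma bracket0r (x : L) : ⁅x, 0⁆ = 0.
Proof.
by have := bracketPr x (-1) 0 0; rewrite scaler0 addr0 scaleN1r addNr.
Qed.

Lemma bracketZl (c : K) (x y : L) : ⁅c *: x, y⁆ = c *: ⁅x, y⁆.
Proof. by rewrite -[c *: x]addr0 bracketPl bracket0l addr0. Qed.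

Lemma bracketZr (c : K) (x y : L) : ⁅x, c *: y⁆ = c *: ⁅x, y⁆.
Proof. by rewrite -[c *: y]addr0 bracketPr bracket0r addr0. Qed.

End BracketScale.

Definition lie_hom (K : fieldType) (L M : lieAlgType K) (f : L -> M) : Prop :=
  linear f /\ forall x y : L, f ⁅x, y⁆ = ⁅f x, f y⁆.

Section Subobjects.
Context {K : fieldType} {L : lieAlgType K}.

Definition is_subspace (S : set L) : Prop :=
  S 0 /\ forall (c : K) (x y : L), S x -> S y -> S (c *: x + y).

Definition is_subalgebra (S : set L) : Prop :=
  is_subspace S /\ forall x y : L, S x -> S y -> S ⁅x, y⁆.

(* One-sided absorption suffices, by antisymmetry of the bracket. *)
Definition is_ideal (S : set L) : Prop :=
  is_subspace S /\ forall x y : L, S y -> S ⁅x, y⁆.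

Definition ideal_gen (G : set L) : set L := smallest is_ideal G.

Definition comm (S T : set L) : set L :=
  smallest is_subspace [set z | exists x y, [/\ S x, T y & z = ⁅x, y⁆]].

Fixpoint derived_series (n : nat) : set L :=
  if n is m.+1 then comm (derived_series m) (derived_series m) else setT.

Fixpoint lower_central_series (n : nat) : set L :=
  if n is m.+1 then comm setT (lower_central_series m) else setT.

End Subobjects.

Definition finitely_generated (K : fieldType) (L : lieAlgType K) : Prop :=
  exists s : seq L, smallest is_subalgebra [set` s] = setT.

Definition solvable_lie (K : fieldType) (L : lieAlgType K) : Prop :=
  exists n : nat, derived_series n = [set 0 : L].

Definition nilpotent_lie (K : fieldType) (L : lieAlgType K) : Prop :=
  exists n : nat, lower_central_series n = [set 0 : L].

(* The free product is the algebra of formal expressions in elements of A and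
   B, modulo the least congruence that forces the Lie algebra laws and makes
   both inclusions homomorphisms.  Zero and opposites are the classes of
   [FPinl 0] and of [FPscale (-1) t]. *)
Section FreeProduct.
Context {K : fieldType} (A B : lieAlgType K).

Inductive fp_term : Type :=
| FPinl of A
| FPinr of B
| FPadd of fp_term & fp_term
| FPscale of K & fp_term
| FPbracket of fp_term & fp_term.

Inductive fp_eq : fp_term -> fp_term -> Prop :=
| fp_refl t : fp_eq t t
| fp_sym s t : fp_eq s t -> fp_eq t s
| fp_trans s t u : fp_eq s t -> fp_eq t u -> fp_eq s u
| fp_congD s s' t t' :
    fp_eq s s' -> fp_eq t t' -> fp_eq (FPadd s t) (FPadd s' t')
| fp_congZ c t t' : fp_eq t t' -> fp_eq (FPscale c t) (FPscale c t')
| fp_congB s s' t t' :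
    fp_eq s s' -> fp_eq t t' -> fp_eq (FPbracket s t) (FPbracket s' t')
| fp_addA s t u : fp_eq (FPadd s (FPadd t u)) (FPadd (FPadd s t) u)
| fp_addC s t : fp_eq (FPadd s t) (FPadd t s)
| fp_add0 t : fp_eq (FPadd (FPinl 0) t) t
| fp_addN t : fp_eq (FPadd (FPscale (-1) t) t) (FPinl 0)
| fp_scaleA b c t : fp_eq (FPscale b (FPscale c t)) (FPscale (b * c) t)
| fp_scale1 t : fp_eq (FPscale 1 t) t
| fp_scaleDr c s t :
    fp_eq (FPscale c (FPadd s t)) (FPadd (FPscale c s) (FPscale c t))
| fp_scaleDl b c t :
    fp_eq (FPscale (b + c) t) (FPadd (FPscale b t) (FPscale c t))
| fp_bracketPl u c s t :
    fp_eq (FPbracket (FPadd (FPscale c s) t) u)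
          (FPadd (FPscale c (FPbracket s u)) (FPbracket t u))
| fp_bracketPr u c s t :
    fp_eq (FPbracket u (FPadd (FPscale c s) t))
          (FPadd (FPscale c (FPbracket u s)) (FPbracket u t))
| fp_bracketxx t : fp_eq (FPbracket t t) (FPinl 0)
| fp_jacobi s t u :
    fp_eq (FPadd (FPadd (FPbracket s (FPbracket t u))
                        (FPbracket t (FPbracket u s)))
                 (FPbracket u (FPbracket s t))) (FPinl 0)
| fp_inlP c x y :
    fp_eq (FPinl (c *: x + y)) (FPadd (FPscale c (FPinl x)) (FPinl y))
| fp_inrP c x y :
    fp_eq (FPinr (c *: x + y)) (FPadd (FPscale c (FPinr x)) (FPinr y))
| fp_inlB x y : fp_eq (FPinl ⁅x, y⁆) (FPbracket (FPinl x) (FPinl y))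
| fp_inrB x y : fp_eq (FPinr ⁅x, y⁆) (FPbracket (FPinr x) (FPinr y)).

HB.instance Definition _ := gen_eqMixin fp_term.
HB.instance Definition _ := gen_choiceMixin fp_term.

Definition fp_eqb (s t : fp_term) : bool := `[< fp_eq s t >].

Lemma fp_eqb_refl : reflexive fp_eqb.
Proof. by move=> t; apply/asboolP/fp_refl. Qed.

Lemma fp_eqb_sym : symmetric fp_eqb.
Proof. by move=> s t; apply/asboolP/asboolP; apply: fp_sym. Qed.

Lemma fp_eqb_trans : transitive fp_eqb.
Proof.
by move=> t s u /asboolP st /asboolP tu; apply/asboolP/(fp_trans st).
Qed.

Canonical fp_equiv := EquivRel fp_eqb fp_eqb_refl fp_eqb_sym fp_eqb_trans.

Definition free_product : Type := {eq_quot fp_equiv}.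
HB.instance Definition _ := Choice.on free_product.
HB.instance Definition _ := EqQuotient.on free_product.

Lemma fp_piP (s t : fp_term) :
  \pi_free_product s = \pi_free_product t <-> fp_eq s t.
Proof.
by split=> [/eqP|st]; [rewrite eqmodE => /asboolP | apply/eqP; rewrite eqmodE; apply/asboolP].
Qed.

Lemma fp_repr_pi (t : fp_term) : fp_eq (repr (\pi_free_product t)) t.
Proof. by apply/fp_piP; rewrite reprK. Qed.

Definition fp_inl (a : A) : free_product := \pi_free_product (FPinl a).
Definition fp_inr (b : B) : free_product := \pi_free_product (FPinr b).
Definition fp_zero : free_product := \pi_free_product (FPinl 0).
Definition fp_add (p q : free_product) : free_product :=
  \pi_free_product (FPadd (repr p) (repr q)).
Definition fp_scale (c : K) (p : free_product) : free_product :=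
  \pi_free_product (FPscale c (repr p)).
Definition fp_opp (p : free_product) : free_product := fp_scale (-1) p.
Definition fp_bracket (p q : free_product) : free_product :=
  \pi_free_product (FPbracket (repr p) (repr q)).

Lemma fp_add_pi s t : fp_add (\pi_free_product s) (\pi_free_product t) = \pi_free_product (FPadd s t).
Proof. by apply/fp_piP/fp_congD; exact: fp_repr_pi. Qed.

Lemma fp_scale_pi c t : fp_scale c (\pi_free_product t) = \pi_free_product (FPscale c t).
Proof. by apply/fp_piP/fp_congZ; exact: fp_repr_pi. Qed.

Lemma fp_bracket_pi s t : fp_bracket (\pi_free_product s) (\pi_free_product t) = \pi_free_product (FPbracket s t).
Proof. by apply/fp_piP/fp_congB; exact: fp_repr_pi. Qed.

Lemma fp_ind (P : free_product -> Prop) :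
  (forall t, P (\pi_free_product t)) -> forall p, P p.
Proof. by move=> Ppi p; rewrite -[p]reprK. Qed.

Definition fp_piE := (fp_add_pi, fp_scale_pi, fp_bracket_pi).

Fact fp_addrA : associative fp_add.
Proof.
elim/fp_ind=> s; elim/fp_ind=> t; elim/fp_ind=> u; rewrite !fp_piE.
exact/fp_piP/fp_addA.
Qed.

Fact fp_addrC : commutative fp_add.
Proof.
by elim/fp_ind=> s; elim/fp_ind=> t; rewrite !fp_piE; exact/fp_piP/fp_addC.
Qed.

Fact fp_add0r : left_id fp_zero fp_add.
Proof. by elim/fp_ind=> t; rewrite !fp_piE; exact/fp_piP/fp_add0. Qed.

Fact fp_addNr : left_inverse fp_zero fp_opp fp_add.
Proof.
by elim/fp_ind=> t; rewrite /fp_opp !fp_piE; exact/fp_piP/fp_addN.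
Qed.

HB.instance Definition _ :=
  GRing.isZmodule.Build free_product fp_addrA fp_addrC fp_add0r fp_addNr.

Fact fp_scalerA b c p : fp_scale b (fp_scale c p) = fp_scale (b * c) p.
Proof. by elim/fp_ind: p => t; rewrite !fp_piE; exact/fp_piP/fp_scaleA. Qed.

Fact fp_scale1r : left_id 1 fp_scale.
Proof. by elim/fp_ind=> t; rewrite !fp_piE; exact/fp_piP/fp_scale1. Qed.

Fact fp_scalerDr : right_distributive fp_scale +%R.
Proof.
move=> c; elim/fp_ind=> s; elim/fp_ind=> t.
by rewrite /GRing.add /= !fp_piE; exact/fp_piP/fp_scaleDr.
Qed.

Fact fp_scalerDl p : {morph fp_scale^~ p : b c / b + c}.
Proof.
elim/fp_ind: p => t b c.
by rewrite {2}/GRing.add /= !fp_piE; exact/fp_piP/fp_scaleDl.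
Qed.

HB.instance Definition _ := GRing.Zmodule_isLmodule.Build K free_product
  fp_scalerA fp_scale1r fp_scalerDr fp_scalerDl.

Lemma fp_addE (s t : fp_term) :
  \pi_free_product s + \pi_free_product t = \pi_free_product (FPadd s t).
Proof. exact: fp_add_pi. Qed.

Lemma fp_scaleE (c : K) (t : fp_term) :
  c *: \pi_free_product t = \pi_free_product (FPscale c t).
Proof. exact: fp_scale_pi. Qed.

Fact fp_bracket_Pl (r : free_product) (c : K) (p q : free_product) :
  fp_bracket (c *: p + q) r = c *: fp_bracket p r + fp_bracket q r.
Proof.
elim/fp_ind: r => u; elim/fp_ind: p => s; elim/fp_ind: q => t.
rewrite fp_scaleE fp_addE !fp_bracket_pi fp_scaleE fp_addE.
exact/fp_piP/fp_bracketPl.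
Qed.

Fact fp_bracket_Pr (r : free_product) (c : K) (p q : free_product) :
  fp_bracket r (c *: p + q) = c *: fp_bracket r p + fp_bracket r q.
Proof.
elim/fp_ind: r => u; elim/fp_ind: p => s; elim/fp_ind: q => t.
rewrite fp_scaleE fp_addE !fp_bracket_pi fp_scaleE fp_addE.
exact/fp_piP/fp_bracketPr.
Qed.

Fact fp_bracket_xx (p : free_product) : fp_bracket p p = 0.
Proof.
by elim/fp_ind: p => t; rewrite fp_bracket_pi; exact/fp_piP/fp_bracketxx.
Qed.

Fact fp_bracket_jacobi (p q r : free_product) :
  fp_bracket p (fp_bracket q r) + fp_bracket q (fp_bracket r p)
    + fp_bracket r (fp_bracket p q) = 0.
Proof.
elim/fp_ind: p => s; elim/fp_ind: q => t; elim/fp_ind: r => u.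
by rewrite !(fp_bracket_pi, fp_addE); exact/fp_piP/fp_jacobi.
Qed.

HB.instance Definition _ := Lmodule_isLieAlgebra.Build K free_product
  fp_bracket_Pl fp_bracket_Pr fp_bracket_xx fp_bracket_jacobi.

Lemma fp_inl_hom : lie_hom fp_inl.
Proof.
split=> [c x y|x y].
  by rewrite /fp_inl fp_scaleE fp_addE; exact/fp_piP/fp_inlP.
rewrite [RHS]fp_bracket_pi; exact/fp_piP/fp_inlB.
Qed.

Lemma fp_inr_hom : lie_hom fp_inr.
Proof.
split=> [c x y|x y].
  by rewrite /fp_inr fp_scaleE fp_addE; exact/fp_piP/fp_inrP.
rewrite [RHS]fp_bracket_pi; exact/fp_piP/fp_inrB.
Qed.

Section UniversalProperty.
Context {C : lieAlgType K} (f : A -> C) (g : B -> C).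

Fixpoint fp_eval (t : fp_term) : C :=
  match t with
  | FPinl a => f a
  | FPinr b => g b
  | FPadd s t => fp_eval s + fp_eval t
  | FPscale c t => c *: fp_eval t
  | FPbracket s t => ⁅fp_eval s, fp_eval t⁆
  end.

(* Meaningful, i.e. independent of the representative, when f and g are
   homomorphisms. *)
Definition fp_lift (p : free_product) : C := fp_eval (repr p).

Hypotheses (fH : lie_hom f) (gH : lie_hom g).

Lemma fp_eval_eq s t : fp_eq s t -> fp_eval s = fp_eval t.
Proof.
have f0 : f 0 = 0.
  by have := fH.1 (-1) 0 0; rewrite scaler0 add0r scaleN1r addNr.
elim=> {s t} //=.
- by move=> s t u _ -> _ ->.
- by move=> s s' t t' _ -> _ ->.
- by move=> c t t' _ ->.
- by move=> s s' t t' _ -> _ ->.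
- by move=> s t u; rewrite addrA.
- by move=> s t; rewrite addrC.
- by move=> t; rewrite f0 add0r.
- by move=> t; rewrite f0 scaleN1r addNr.
- by move=> b c t; rewrite scalerA.
- by move=> t; rewrite scale1r.
- by move=> c s t; rewrite scalerDr.
- by move=> b c t; rewrite scalerDl.
- by move=> u c s t; rewrite bracketPl.
- by move=> u c s t; rewrite bracketPr.
- by move=> t; rewrite f0 bracketxx.
- by move=> s t u; rewrite f0 jacobi.
- by move=> c x y; rewrite fH.1.
- by move=> c x y; rewrite gH.1.
- by move=> x y; rewrite fH.2.
- by move=> x y; rewrite gH.2.
Qed.

Lemma fp_lift_pi t : fp_lift (\pi_free_product t) = fp_eval t.
Proof. exact/fp_eval_eq/fp_repr_pi. Qed.

Lemma fp_lift_inl a : fp_lift (fp_inl a) = f a.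
Proof. exact: fp_lift_pi. Qed.

Lemma fp_lift_inr b : fp_lift (fp_inr b) = g b.
Proof. exact: fp_lift_pi. Qed.

Lemma fp_lift_hom : lie_hom fp_lift.
Proof.
split=> [c|]; elim/fp_ind=> s; elim/fp_ind=> t.
  by rewrite fp_scaleE fp_addE !fp_lift_pi.
by rewrite [X in fp_lift X]fp_bracket_pi !fp_lift_pi.
Qed.

Lemma fp_lift_unique (h : free_product -> C) : lie_hom h ->
  (forall a, h (fp_inl a) = f a) -> (forall b, h (fp_inr b) = g b) ->
  h = fp_lift.
Proof.
move=> [hlin hbr] hl hr; apply/funext; elim/fp_ind=> t; rewrite fp_lift_pi.
have h0 : h 0 = 0.
  by have := hlin (-1) 0 0; rewrite scaler0 add0r scaleN1r addNr.
elim: t => [a|b|s IHs t IHt|c t IHt|s IHs t IHt] /=.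
- exact: hl.
- exact: hr.
- by rewrite -IHs -IHt -fp_addE -[\pi_free_product s]scale1r hlin !scale1r.
- by rewrite -IHt -fp_scaleE -[_ *: _]addr0 hlin h0 addr0.
- by rewrite -IHs -IHt -hbr; congr h; rewrite [RHS]fp_bracket_pi.
Qed.

End UniversalProperty.
End FreeProduct.

Definition line (K : fieldType) : Type := K^o.
HB.instance Definition _ (K : fieldType) := GRing.Lmodule.on (line K).

Definition line_bracket (K : fieldType) (x y : line K) : line K := 0.

Section LineLie.
Context (K : fieldType).

Fact line_bracketPl (z : line K) (c : K) (x y : line K) :
  line_bracket (c *: x + y) z = c *: line_bracket x z + line_bracket y z.
Proof. by rewrite /line_bracket scaler0 addr0. Qed.

Fact line_bracketPr (z : line K) (c : K) (x y : line K) :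
  line_bracket z (c *: x + y) = c *: line_bracket z x + line_bracket z y.
Proof. by rewrite /line_bracket scaler0 addr0. Qed.

Fact line_bracketxx (x : line K) : line_bracket x x = 0.
Proof. by []. Qed.

Fact line_jacobi (x y z : line K) :
  line_bracket x (line_bracket y z) + line_bracket y (line_bracket z x)
    + line_bracket z (line_bracket x y) = 0.
Proof. by rewrite /line_bracket !addr0. Qed.

HB.instance Definition _ := Lmodule_isLieAlgebra.Build K (line K)
  line_bracketPl line_bracketPr line_bracketxx line_jacobi.

End LineLie.

Section Equations.
Context {K : fieldType} {A : lieAlgType K}.

(* A * <x>, where <x> is [line K] and x is its element 1. *)
Definition adjoin_unknown : Type := free_product A (line K).
HB.instance Definition _ := LieAlgebra.on adjoin_unknown.

Definition coef (a : A) : adjoin_unknown := fp_inl (line K) a.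
Definition unknown : adjoin_unknown := @fp_inr K A (line K) (1 : K^o).

Definition nonsingular (w : adjoin_unknown) : Prop :=
  ~ ideal_gen (range coef) w.

Definition eval_at (a : A) : adjoin_unknown -> A :=
  fp_lift idfun (fun c : line K => (c : K) *: a).

Lemma scale_line_hom (a : A) : lie_hom (fun c : line K => (c : K) *: a).
Proof.
split=> [c x y|x y]; first by rewrite scalerDl scalerA.
by rewrite bracketZl bracketZr bracketxx !scaler0 scale0r.
Qed.

Lemma eval_at_hom (a : A) : lie_hom (eval_at a).
Proof. by apply: fp_lift_hom; [split | exact: scale_line_hom]. Qed.

Lemma eval_at_coef (a b : A) : eval_at a (coef b) = b.
Proof. by apply: fp_lift_inl; [split | exact: scale_line_hom]. Qed.

Lemma eval_at_unknown (a : A) : eval_at a unknown = a.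
Proof.
rewrite /eval_at fp_lift_inr ?scale1r //; exact: scale_line_hom.
Qed.

Definition solution (w : adjoin_unknown) (a : A) : Prop := eval_at a w = 0.

End Equations.

Arguments adjoin_unknown {K} A.

(* Main.v *)
Require Import Defs.
From mathcomp Require Import all_boot all_order all_algebra.
From mathcomp Require Import boolp classical_sets.
From mathcomp Require Import mpoly.

(* A nilpotent: a nonsingular w is c x + v with c <> 0 and v in the ideal
   generated by A, and a |-> v(a) maps congruence modulo the n-th term of the
   lower central series to congruence modulo the next one.  So iterating
   a |-> - c^-1 v(a) reaches a solution.

   Conversely only the equations g(ad z) x = y with g(0) <> 0 are needed
   ([adp g z x] is g(ad z) x).  By
   induction along the derived series, one has to show that A acts nilpotently
   on an abelian section P/Q of A, where A/P is nilpotent, A is spanned modulo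
   P by a list e in which every element is central modulo the previous ones,
   and P/Q is a finitely generated module.  The elements z of e are treated one
   after the other, so that z commutes with the action of A on P/Q, and P/Q is
   a module over K[X] through ad z.  For every g with g(0) <> 0, g P + Q = P.
   Generic freeness holds in the following form: order the monomials in e
   applied to a generator by degree and then lexicographically; the ideals of
   leading coefficients in K[X] increase under multiplication, so by Dickson's
   lemma there is f <> 0 that lies in all the nonzero ones.  Then h = 1 + X f
   acts injectively on the successive quotients of the filtration by leading
   monomials, so divisibility by h passes to them and excludes the free ones.
   Hence a power of f kills P/Q, and, writing f = X^a g with g(0) <> 0,
   so does a power of ad z. *)

Set Implicit Arguments.
Unset Strict Implicit.
Unset Printing Implicit Defensive.

Import Order.TTheory GRing.Theory.
Import generic_quotient.
Local Open Scope ring_scope.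
Local Open Scope classical_set_scope.
Local Open Scope quotient_scope.

(** * Subspaces, ideals and commutators *)

Section Subspaces.
Context {K : fieldType} {A : lieAlgType K}.
Implicit Types (a b c x y z u v : A) (G S T P Q R : set A).

Lemma bracketDl x y z : ⁅x + y, z⁆ = ⁅x, z⁆ + ⁅y, z⁆.
Proof. by have := bracketPl z 1 x y; rewrite !scale1r. Qed.

Lemma bracketDr x y z : ⁅z, x + y⁆ = ⁅z, x⁆ + ⁅z, y⁆.
Proof. by have := bracketPr z 1 x y; rewrite !scale1r. Qed.

Lemma bracketNl x y : ⁅- x, y⁆ = - ⁅x, y⁆.
Proof. by rewrite -!scaleN1r bracketZl. Qed.

Lemma bracketNr x y : ⁅x, - y⁆ = - ⁅x, y⁆.
Proof. by rewrite -!scaleN1r bracketZr. Qed.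

Lemma bracketBr x y z : ⁅z, x - y⁆ = ⁅z, x⁆ - ⁅z, y⁆.
Proof. by rewrite bracketDr bracketNr. Qed.

Lemma bracketBl x y z : ⁅x - y, z⁆ = ⁅x, z⁆ - ⁅y, z⁆.
Proof. by rewrite bracketDl bracketNl. Qed.

Lemma bracketC x y : ⁅x, y⁆ = - ⁅y, x⁆.
Proof.
apply/eqP; rewrite -addr_eq0; apply/eqP.
by have := bracketxx (x + y); rewrite bracketDl !bracketDr !bracketxx addr0 add0r.
Qed.

Lemma bracket_leibniz x y z : ⁅x, ⁅y, z⁆⁆ = ⁅⁅x, y⁆, z⁆ + ⁅y, ⁅x, z⁆⁆.
Proof.
have /eqP := jacobi x y z; rewrite -addrA addr_eq0 => /eqP ->.
by rewrite opprD addrC (bracketC ⁅x, y⁆) (bracketC z x) bracketNr opprK.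
Qed.

Lemma subspaceD S x y : is_subspace S -> S x -> S y -> S (x + y).
Proof. by move=> [_ H] Sx Sy; rewrite -[x]scale1r; apply: H. Qed.

Lemma subspaceZ S (k : K) x : is_subspace S -> S x -> S (k *: x).
Proof. by move=> [S0 H] Sx; rewrite -[_ *: _]addr0; apply: H. Qed.

Lemma subspaceN S x : is_subspace S -> S x -> S (- x).
Proof. by move=> sS Sx; rewrite -scaleN1r; apply: subspaceZ. Qed.

Lemma subspaceB S x y : is_subspace S -> S x -> S y -> S (x - y).
Proof. by move=> sS Sx Sy; apply: subspaceD => //; apply: subspaceN. Qed.

Lemma subspace_cong S x y : is_subspace S -> S (x - y) -> S y -> S x.
Proof. by move=> sS Sxy Sy; rewrite -(subrK y x); apply: subspaceD. Qed.

Lemma idealS S : is_ideal S -> is_subspace S. Proof. by case. Qed.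

Lemma ideal0 S : is_ideal S -> S 0. Proof. by case=> -[]. Qed.

Lemma ideal_bracketr S x y : is_ideal S -> S y -> S ⁅x, y⁆.
Proof. by case=> _; apply. Qed.

Lemma ideal_bracketl S x y : is_ideal S -> S x -> S ⁅x, y⁆.
Proof. by move=> iS Sx; rewrite bracketC; apply: (subspaceN iS.1); apply: ideal_bracketr. Qed.

Definition lspan G : set A := smallest is_subspace G.

Lemma lspan_subspace G : is_subspace (lspan G).
Proof.
split=> [S [[]]//|k x y Gx Gy S [sS GS]].
by apply: sS.2; [apply: Gx | apply: Gy].
Qed.

Lemma sub_lspan G : G `<=` lspan G. Proof. exact: sub_smallest. Qed.

Lemma lspan_sub G S : is_subspace S -> G `<=` S -> lspan G `<=` S.
Proof. exact: smallest_sub. Qed.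

Lemma lspanS G T : G `<=` T -> lspan G `<=` lspan T.
Proof. by move=> GT; apply: lspan_sub (lspan_subspace T) _ => x /GT; apply: sub_lspan. Qed.

Lemma ideal_gen_ideal G : is_ideal (ideal_gen G).
Proof.
split=> [|x y Gy S [iS GS]]; last by apply: iS.2; apply: Gy.
split=> [S [[[]]]//|k x y Gx Gy S [iS GS]].
by apply: iS.1.2; [apply: Gx | apply: Gy].
Qed.

Lemma sub_ideal_gen G : G `<=` ideal_gen G. Proof. exact: sub_smallest. Qed.

Lemma ideal_gen_sub G S : is_ideal S -> G `<=` S -> ideal_gen G `<=` S.
Proof. exact: smallest_sub. Qed.

Lemma ideal_genS G T : G `<=` T -> ideal_gen G `<=` ideal_gen T.
Proof. by move=> GT; apply: ideal_gen_sub (ideal_gen_ideal T) _ => x /GT; apply: sub_ideal_gen. Qed.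

Lemma ideal_genU_sub Q G P : is_ideal P -> Q `<=` P -> G `<=` P ->
  ideal_gen (Q `|` G) `<=` P.
Proof. by move=> iP QP GP; apply: ideal_gen_sub => // x [/QP|/GP]. Qed.

Lemma idealT : is_ideal [set: A]. Proof. by []. Qed.

Lemma comm_subspace S T : is_subspace (comm S T).
Proof. exact: lspan_subspace. Qed.

Lemma comm_bracket S T x y : S x -> T y -> comm S T ⁅x, y⁆.
Proof. by move=> Sx Ty; apply: sub_lspan; exists x, y. Qed.

Lemma comm_sub S T R : is_subspace R ->
  (forall x y, S x -> T y -> R ⁅x, y⁆) -> comm S T `<=` R.
Proof. by move=> sR H; apply: lspan_sub => // z [x [y [Sx Ty ->]]]; apply: H. Qed.

Lemma comm_ideal S T : is_ideal S -> is_ideal T -> is_ideal (comm S T).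
Proof.
move=> iS iT; split=> [|a]; first exact: comm_subspace.
have sC := comm_subspace S T.
suff: comm S T `<=` [set y | comm S T ⁅a, y⁆] by [].
apply: comm_sub => [|x y Sx Ty /=].
  split=> [|k x y Hx Hy] /=; first by rewrite bracket0r; case: sC.
  by rewrite bracketPr; apply: sC.2.
rewrite bracket_leibniz; apply: (subspaceD sC); apply: comm_bracket => //.
  exact: ideal_bracketr.
exact: ideal_bracketr.
Qed.

Lemma comm_subr S T : is_ideal T -> comm S T `<=` T.
Proof. by move=> iT; apply: comm_sub; [exact: idealS | move=> x y _; apply: ideal_bracketr]. Qed.

(** For [P = setT] this is the lower central series; [desc k P] contained in Q means that A acts
    nilpotently on P/Q. *)
Definition desc k (P : set A) : set A := iter k (comm setT) P.

Lemma desc_mono k P Q : P `<=` Q -> desc k P `<=` desc k Q.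
Proof.
move=> PQ; elim: k => //= k IH; apply: comm_sub; first exact: comm_subspace.
by move=> x y _ /IH; apply: comm_bracket.
Qed.

Lemma desc_trans k l P Q R : desc k P `<=` Q -> desc l Q `<=` R ->
  desc (l + k) P `<=` R.
Proof.
move=> PQ QR; rewrite /desc iterD; apply: subset_trans QR; exact: desc_mono.
Qed.

Lemma lower_central_desc n : lower_central_series n = desc n setT.
Proof. by elim: n => //= n ->. Qed.

Lemma desc_ideal k P : is_ideal P -> is_ideal (desc k P).
Proof. by move=> iP; elim: k => //= k IH; apply: comm_ideal. Qed.

Lemma derived_ideal n : is_ideal (derived_series n : set A).
Proof. by elim: n => //= n IH; apply: comm_ideal. Qed.

End Subspaces.

(** * Polynomials in ad z *)

Section AdPoly.
Context {K : fieldType} {A : lieAlgType K}.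
Implicit Types (a b c x y z u v : A) (G S T P Q R : set A) (p q : {poly K}).

Definition adp p z u : A :=
  \sum_(i < size p) p`_i *: iter i (fun v => ⁅z, v⁆) u.

Lemma adp_widen n p z u : (size p <= n)%N ->
  adp p z u = \sum_(i < n) p`_i *: iter i (fun v => ⁅z, v⁆) u.
Proof.
move=> le_pn; rewrite /adp (big_ord_widen _ (fun i => p`_i *: iter i _ u) le_pn).
rewrite big_mkcond; apply: eq_bigr => i _; case: ltnP => // le_pi.
by rewrite nth_default // scale0r.
Qed.

Lemma adp_lin z u (k : K) p q : adp (k *: p + q) z u = k *: adp p z u + adp q z u.
Proof.
pose n := maxn (size (k *: p + q)) (maxn (size p) (size q)).
have [h1 [h2 h3]] : (size (k *: p + q)%R <= n /\ size p <= n /\ size q <= n)%N.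
  by rewrite !leq_max !leqnn !orbT.
rewrite !(@adp_widen n) // scaler_sumr -big_split /=; apply: eq_bigr => i _.
by rewrite coefD coefZ scalerDl scalerA.
Qed.

Lemma adpD p q z u : adp (p + q) z u = adp p z u + adp q z u.
Proof. by have := adp_lin z u 1 p q; rewrite !scale1r. Qed.

Lemma adp0 z u : adp 0 z u = 0.
Proof. by rewrite /adp size_poly0 big_ord0. Qed.

Lemma adpZ k p z u : adp (k *: p) z u = k *: adp p z u.
Proof. by have := adp_lin z u k p 0; rewrite adp0 !addr0. Qed.

Lemma adpC k z u : adp k%:P z u = k *: u.
Proof.
by rewrite (@adp_widen 1) ?size_polyC ?leq_b1 // big_ord1 coefC.
Qed.

Lemma adp1 z u : adp 1 z u = u.
Proof. by rewrite -polyC1 adpC scale1r. Qed.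

Lemma bracket_sumr I (r : seq I) (F : I -> A) z :
  ⁅z, \sum_(i <- r) F i⁆ = \sum_(i <- r) ⁅z, F i⁆.
Proof.
by elim/big_rec2: _ => [|i x y _ <-]; rewrite ?bracket0r // bracketDr.
Qed.

Lemma adpMX p z u : adp (p * 'X) z u = ⁅z, adp p z u⁆.
Proof.
have h : (size (p * 'X)%R <= (size p).+1)%N.
  by rewrite (leq_trans (size_polyMleq _ _)) // size_polyX addn2.
rewrite (adp_widen _ _ h) big_ord_recl coefMX scale0r add0r /adp bracket_sumr.
by apply: eq_bigr => i _; rewrite coefMX /= bracketZr.
Qed.

Lemma adp_X z u : adp 'X z u = ⁅z, u⁆.
Proof. by rewrite -['X]mul1r adpMX adp1. Qed.

Lemma adpM p q z u : adp (p * q) z u = adp p z (adp q z u).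
Proof.
elim/poly_ind: p => [|p k IH]; first by rewrite mul0r !adp0.
by rewrite mulrDl -mulrA (mulrC 'X) mulrA !adpD !adpMX IH mul_polyC adpZ adpC.
Qed.

Lemma adp_linr p z (k : K) u v : adp p z (k *: u + v) = k *: adp p z u + adp p z v.
Proof.
elim/poly_ind: p => [|p l IH]; first by rewrite !adp0 scaler0 addr0.
rewrite !adpD !adpMX IH bracketPr !adpC scalerDr !scalerDr !scalerA (mulrC l k).
by rewrite addrACA.
Qed.

Lemma adpDr p z u v : adp p z (u + v) = adp p z u + adp p z v.
Proof. by have := adp_linr p z 1 u v; rewrite !scale1r. Qed.

Lemma adp0r p z : adp p z 0 = 0.
Proof. by have := adp_linr p z (-1) 0 0; rewrite scaler0 addr0 scaleN1r addNr. Qed.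

Lemma adpZr p z (k : K) u : adp p z (k *: u) = k *: adp p z u.
Proof. by have := adp_linr p z k u 0; rewrite adp0r !addr0. Qed.

Lemma adpNr p z u : adp p z (- u) = - adp p z u.
Proof. by rewrite -!scaleN1r adpZr. Qed.

Lemma adpBr p z u v : adp p z (u - v) = adp p z u - adp p z v.
Proof. by rewrite adpDr adpNr. Qed.

Lemma adp_stable S p z u : is_subspace S -> (forall x, S x -> S ⁅z, x⁆) ->
  S u -> S (adp p z u).
Proof.
move=> sS Sz Su; elim/poly_ind: p => [|p l IH]; first by rewrite adp0; case: sS.
rewrite adpD adpMX adpC; apply: (subspaceD sS); first exact: Sz.
exact: subspaceZ.
Qed.

Lemma adp_ideal S p z u : is_ideal S -> S u -> S (adp p z u).
Proof. by move=> iS; apply: adp_stable; [exact: idealS | move=> x Sx; apply: ideal_bracketr]. Qed.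

(** When ⁅a, z⁆ kills P/Q, ad a and ad z commute there by the Leibniz rule, hence so do ad a and
    p(ad z). *)
Lemma adp_comm P Q p a z u : is_ideal P -> is_ideal Q ->
  (forall x, P x -> Q ⁅⁅a, z⁆, x⁆) -> P u ->
  Q (⁅a, adp p z u⁆ - adp p z ⁅a, u⁆).
Proof.
move=> iP iQ Qaz Pu; elim/poly_ind: p => [|p l IH].
  by rewrite !adp0 bracket0r subr0; case: iQ => -[].
rewrite !adpD !adpMX !adpC bracketDr bracketZr opprD addrACA subrr addr0.
rewrite bracket_leibniz -addrA; apply: (subspaceD iQ.1).
  by apply: Qaz; apply: adp_ideal.
by rewrite -bracketBr; apply: ideal_bracketr.
Qed.

Lemma adp_bracket p z u : adp p z ⁅z, u⁆ = ⁅z, adp p z u⁆.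
Proof. by rewrite -adpMX -adp_X -adpM. Qed.

End AdPoly.

(** * Homomorphisms and polynomials in ad z *)

Section LieHom.
Context {K : fieldType} {A B : lieAlgType K} (f : A -> B).
Hypothesis fH : lie_hom f.

Lemma lie_hom0 : f 0 = 0.
Proof. by have := fH.1 (-1) 0 0; rewrite scaler0 addr0 scaleN1r addNr. Qed.

Lemma lie_homZ (c : K) x : f (c *: x) = c *: f x.
Proof. by rewrite -[c *: x]addr0 fH.1 lie_hom0 addr0. Qed.

Lemma lie_homD x y : f (x + y) = f x + f y.
Proof. by have := fH.1 1 x y; rewrite !scale1r. Qed.

Lemma lie_homB x y : f (x - y) = f x - f y.
Proof. by rewrite lie_homD -scaleN1r lie_homZ scaleN1r. Qed.

Lemma adp_hom p z u : f (adp p z u) = adp p (f z) (f u).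
Proof.
elim/poly_ind: p => [|p l IH]; first by rewrite !adp0 lie_hom0.
by rewrite !adpD !adpMX !adpC lie_homD lie_homZ fH.2 IH.
Qed.

End LieHom.

(** * Generic freeness for cyclic modules *)

(** Induction on the number of coordinates. Let [s] serve for the first k of them and let [a] bound
    coordinate k on [s]. Points with coordinate k at least [a] lie above [s]; each of the finitely
    many slices with a smaller value gets its own list. *)
Lemma dickson (T : eqType) (f : nat -> T -> nat) k (D : set T) :
  exists s : seq T, (forall x, x \in s -> D x) /\
    forall x, D x -> exists2 y, y \in s & forall i, (i < k)%N -> (f i y <= f i x)%N.
Proof.
elim: k D => [|k IH] D.
  have [[x Dx]|nD] := pselect (exists x, D x); last first.
    by exists [::]; split=> // x Dx; case: nD; exists x.
  by exists [:: x]; split=> [y|y _]; [rewrite inE => /eqP -> | exists x; rewrite ?mem_head].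
have [s [sD sP]] := IH D.
pose a := (\max_(y <- s) f k y)%N.
have /choice[t tP] b := IH [set x | D x /\ f k x = b].
exists (s ++ flatten [seq t b | b <- iota 0 a]); split=> [x|x Dx].
  by rewrite mem_cat => /orP[/sD//|/flatten_mapP[b _ /(tP b).1 []]].
have [le_ax|lt_xa] := leqP a (f k x).
  have [y ys yx] := sP x Dx; exists y; first by rewrite mem_cat ys.
  move=> i; rewrite ltnS leq_eqVlt => /orP[/eqP->|/yx//].
  by apply: leq_trans le_ax; exact: leq_bigmax_seq.
have [y yt yx] := (tP (f k x)).2 x (conj Dx erefl); exists y.
  rewrite mem_cat; apply/orP; right; apply/flatten_mapP; exists (f k x) => //.
  by rewrite mem_iota.
move=> i; rewrite ltnS leq_eqVlt => /orP[/eqP->|/yx//].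
by rewrite ((tP (f k x)).1 y yt).2.
Qed.

Lemma mnm_dickson n (D : set 'X_{1..n}) :
  exists s : seq 'X_{1..n}, (forall x, x \in s -> D x) /\
    forall x, D x -> exists2 y, y \in s & (y <= x)%MM.
Proof.
pose f i (m : 'X_{1..n}) := if insub i is Some j then m j else 0%N.
have [s [sD sP]] := dickson f n D; exists s; split=> // x /sP[y ys yx].
by exists y => //; apply/mnm_lepP => i; have := yx i (ltn_ord i); rewrite /f valK.
Qed.

Lemma ltmc_mdeg n (m k : 'X_{1..n}) : (mdeg m < mdeg k)%N -> (m < k)%O.
Proof. by rewrite ltNge => lt_mk; apply: contraL lt_mk => /lemc_mdeg; rewrite -leqNgt. Qed.

Section CyclicModule.
Context {K : fieldType} {A : lieAlgType K}.
Variables (J P Q : set A) (e : seq A) (z v : A).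
Hypotheses (iP : is_ideal P) (iQ : is_ideal Q) (QP : Q `<=` P).
Hypothesis eT : forall a, lspan ([set` e] `|` J) a.
Hypothesis JP : forall a x, J a -> P x -> Q ⁅a, x⁆.
Hypothesis zC : forall a x, P x -> Q ⁅⁅a, z⁆, x⁆.
Hypothesis Pv : P v.

Let n := size e.

(* No quotient is formed: P/Q is a K[X]-module through ad z, and its submodules
   are represented by their preimages in P. *)
Definition zsub (S : set A) :=
  [/\ is_subspace S, Q `<=` S & forall x, S x -> S ⁅z, x⁆].

Definition zspan (B : set A) : set A := smallest zsub B.

Lemma zspan_zsub B : zsub (zspan B).
Proof.
split=> [|x Qx S [[_ QS _] _]|x Bx S SP]; last 2 first.
- exact: QS.
- by case: (SP) => -[_ _ Sz] _; apply: Sz; apply: Bx.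
split=> [S [[[S0 _] _ _] _] //|k x y Bx By S SP]; case: (SP) => -[sS _ _] _.
by apply: sS.2; [apply: Bx|apply: By].
Qed.

Lemma zspan_subspace B : is_subspace (zspan B). Proof. by case: (zspan_zsub B). Qed.

Lemma subQ_zspan B : Q `<=` zspan B. Proof. by case: (zspan_zsub B). Qed.

Lemma sub_zspan B : B `<=` zspan B. Proof. exact: sub_smallest. Qed.

Lemma zspan_sub B S : zsub S -> B `<=` S -> zspan B `<=` S.
Proof. exact: smallest_sub. Qed.

Lemma zspanS B C : B `<=` C -> zspan B `<=` zspan C.
Proof. by move=> BC; apply: zspan_sub (zspan_zsub C) _ => x /BC; apply: sub_zspan. Qed.

Lemma zspan_adp B p u : zspan B u -> zspan B (adp p z u).
Proof. by case: (zspan_zsub B) => sB _ Bz; apply: adp_stable. Qed.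

Lemma zsub_P : zsub P.
Proof. by split=> // [|x Px]; [exact: idealS | apply: ideal_bracketr]. Qed.

(** Such u form a [zsub]: linear combinations combine the polynomials c, and ad z multiplies c by
    X. *)
Lemma zspan_dec B b u : zspan (B `|` [set b]) u -> exists c, zspan B (u - adp c z b).
Proof.
have [sB QB Bz] := zspan_zsub B.
apply: (@zspan_sub _ [set u | exists c, zspan B (u - adp c z b)]); last first.
  move=> x [Bx|->]; first by exists 0; rewrite adp0 subr0; apply: sub_zspan.
  by exists 1; rewrite adp1 subrr; case: sB.
split=> [|x Qx|x [c Hc]]; last 2 first.
- by exists 0; rewrite adp0 subr0; apply: QB.
- by exists (c * 'X); rewrite adpMX -bracketBr; apply: Bz.
split=> [|k x y [c Hc] [d Hd]]; first by exists 0; rewrite adp0 subr0; case: sB.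
exists (k *: c + d); rewrite adp_lin opprD addrACA -scalerBr.
exact: sB.2.
Qed.

(** As ⁅a, z⁆ kills P/Q, ad a is K[X]-linear there, so generators decide. Membership in P is carried
    along because [zC] applies only there. *)
Lemma bracket_zspan (B S : set A) a : B `<=` P -> zsub S ->
  (forall b, B b -> S ⁅a, b⁆) -> forall u, zspan B u -> S ⁅a, u⁆.
Proof.
move=> BP [sS QS Sz] SB u Bu; suff [] : P u /\ S ⁅a, u⁆ by [].
move: u Bu; apply: (@zspan_sub _ [set u | P u /\ S ⁅a, u⁆]) => [|b Bb]; last first.
  by split; [apply: BP | apply: SB].
split=> [|x Qx|x [Px Sx]].
- split=> [|k x y [Px Sx] [Py Sy]].
    by split; [exact: ideal0 | rewrite bracket0r; case: sS].
  by split; [apply: iP.1.2 | rewrite bracketPr; apply: sS.2].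
- by split; [exact: QP | apply: QS; apply: ideal_bracketr].
- split; first exact: ideal_bracketr.
  by rewrite bracket_leibniz; apply: (subspaceD sS); [apply: QS; apply: zC | apply: Sz].
Qed.

Lemma bracket_gen (S T : set A) : is_subspace T -> Q `<=` T -> S `<=` P ->
  (forall (j : 'I_n) u, S u -> T ⁅e`_j, u⁆) -> forall a u, S u -> T ⁅a, u⁆.
Proof.
move=> sT QT SP He a; have := eT a; move: a.
apply: (@lspan_sub _ _ _ [set a | forall u, S u -> T ⁅a, u⁆]).
  split=> [u _|k x y Hx Hy u Su]; first by rewrite bracket0l; case: sT.
  by rewrite bracketPl; apply: sT.2; [apply: Hx|apply: Hy].
move=> a [/(nthP 0)[i lt_i <-]|Ja] u Su; first exact: (He (Ordinal lt_i)).
by apply: QT; apply: JP => //; apply: SP.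
Qed.

(** * Words in [e] applied to v, and their reordering *)

Definition act (w : seq 'I_n) : A := foldr (fun (j : 'I_n) u => ⁅e`_j, u⁆) v w.

Lemma actP w : P (act w).
Proof. by elim: w => //= j w IH; apply: ideal_bracketr. Qed.

Definition actle d : set A := [set u | exists2 w, (size w <= d)%N & u = act w].

Notation Wd d := (zspan (actle d)).

Lemma actleP d : actle d `<=` P.
Proof. by move=> _ [w _ ->]; apply: actP. Qed.

Lemma Wd_P d : Wd d `<=` P.
Proof. by apply: zspan_sub zsub_P _; apply: actleP. Qed.

Lemma act_Wd w d : (size w <= d)%N -> Wd d (act w).
Proof. by move=> le_wd; apply: sub_zspan; exists w. Qed.

Lemma bracket_Wd d a u : Wd d u -> Wd d.+1 ⁅a, u⁆.
Proof.
move: a u; apply: bracket_gen; [exact: zspan_subspace|exact: subQ_zspan|exact: Wd_P|].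
move=> j; apply: bracket_zspan; [exact: actleP|exact: zspan_zsub|].
by move=> _ [w le_wd ->]; apply: (@act_Wd (j :: w)).
Qed.

(** Exchanging two neighbouring letters costs a term in which the single element ⁅e_j, e_i⁆ of A
    replaces both, hence one of smaller length, as in the spanning half of the
    Poincaré-Birkhoff-Witt theorem. *)
Lemma act_move d j p1 p2 : (size p1 + size p2 <= d)%N ->
  Wd d (act (j :: p1 ++ p2) - act (p1 ++ j :: p2)).
Proof.
elim: p1 d => [|i p1 IH] d; first by rewrite subrr => _; case: (zspan_subspace (actle d)).
case: d => // d le_d; have sW := zspan_subspace (actle d.+1).
have Wu : Wd d (act (p1 ++ p2)) by apply: act_Wd; rewrite size_cat.
rewrite /= bracket_leibniz -addrA; apply: (subspaceD sW); first exact: bracket_Wd.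
by rewrite -bracketBr; apply: bracket_Wd; apply: IH.
Qed.

Lemma act_perm d w w' : perm_eq w w' -> (size w <= d.+1)%N -> Wd d (act w - act w').
Proof.
elim: w w' d => [|j w IH] w' d.
  rewrite perm_sym => /perm_nilP -> _; rewrite subrr.
  by case: (zspan_subspace (actle d)).
move=> eqw le_d; have sW := zspan_subspace (actle d).
have jw' : j \in w' by rewrite -(perm_mem eqw) mem_head.
case/splitPr: jw' eqw => p1 p2; rewrite perm_sym -cat1s perm_catCA /= perm_cons perm_sym => eqw.
have szw : (size p1 + size p2 <= d)%N by rewrite -size_cat -(perm_size eqw).
apply: (subspace_cong sW) (act_move j szw).
rewrite opprB addrA subrK /= -bracketBr.
case: d le_d szw sW {IH} (IH (p1 ++ p2)) => [|d] le_d szw sW IH; last first.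
  by apply: bracket_Wd; apply: IH.
move: le_d eqw; rewrite ltnS leqn0 size_eq0 => /eqP ->; rewrite perm_sym => /perm_nilP ->.
by rewrite subrr bracket0r; case: sW.
Qed.

(** * Sorted words, monomials and leading coefficients *)

Definition word (m : 'X_{1..n}) : seq 'I_n := flatten [seq nseq (m j) j | j <- enum 'I_n].

Lemma count_word (m : 'X_{1..n}) j : count_mem j (word m) = m j.
Proof.
rewrite /word count_flatten -map_comp sumnE big_map big_enum /=.
rewrite (bigD1 j) //= count_nseq /= eqxx mul1n big1 ?addn0 // => i /negPf ij.
by rewrite count_nseq /= ij.
Qed.

Lemma perm_word w (m : 'X_{1..n}) : (forall j, count_mem j w = m j) -> perm_eq w (word m).
Proof. by move=> wm; apply/allP => j _ /=; rewrite wm count_word. Qed.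

Lemma size_word m : size (word m) = mdeg m.
Proof.
rewrite /word size_flatten /shape -map_comp sumnE big_map big_enum mdegE.
by apply: eq_bigr => i _; rewrite /= size_nseq.
Qed.

Definition mon m : A := act (word m).

Definition mons (D : set 'X_{1..n}) : set A := [set mon m | m in D].

Notation W D := (zspan (mons D)).

Lemma monsP D : mons D `<=` P.
Proof. by move=> _ [m _ <-]; apply: actP. Qed.

Lemma monsS D D' : D `<=` D' -> W D `<=` W D'.
Proof. by move=> DD; apply: zspanS => _ [m Dm <-]; exists m => //; apply: DD. Qed.

(** Sorting a word changes it by shorter words only, which the induction on d covers. *)
Lemma Wd_mdeg d : zspan (actle d) `<=` W [set m | (mdeg m <= d)%N].
Proof.
elim: d => [|d IH]; apply: zspan_sub (zspan_zsub _) _ => _ [w le_w ->];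
  pose m := [multinom count_mem j w | j < n];
  have pwm : perm_eq w (word m) by apply: perm_word => j; rewrite mnmE.
  apply: sub_zspan; exists m => /=; first by rewrite -size_word -(perm_size pwm).
  move: pwm; move: le_w; rewrite leqn0 size_eq0 => /eqP ->.
  by rewrite perm_sym => /perm_nilP; rewrite /mon => ->.
have sW := zspan_subspace (mons [set m | (mdeg m <= d.+1)%N]).
apply: (@subspace_cong _ _ _ _ (mon m) sW).
  apply: (@monsS [set m | (mdeg m <= d)%N]) => [k /= /leqW //|].
  by apply: IH; apply: act_perm.
by apply: sub_zspan; exists m => //=; rewrite -size_word -(perm_size pwm).
Qed.

Lemma bracket_mon (j : 'I_n) m (D : set 'X_{1..n}) :
  (forall k, (mdeg k <= mdeg m)%N -> D k) ->
  W D (⁅e`_j, mon m⁆ - mon (m + U_(j))%MM).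
Proof.
move=> HD; apply: (@monsS [set k | (mdeg k <= mdeg m)%N]) => //; apply: Wd_mdeg; apply: (@act_perm _ (j :: word m)); last by rewrite /= size_word.
by apply: perm_word => i; rewrite /= count_word mnmDE mnm1E addnC.
Qed.

Lemma bracket_Wlt (j : 'I_n) m u :
  W [set k | (k < m)%O] u -> W [set k | (k < (m + U_(j))%MM)%O] ⁅e`_j, u⁆.
Proof.
apply: bracket_zspan; [exact: monsP | exact: zspan_zsub |].
have sW := zspan_subspace (mons [set k | (k < (m + U_(j))%MM)%O]).
move=> _ [k /= lt_km <-]; apply: (subspace_cong sW); last first.
  by apply: sub_zspan; exists (k + U_(j))%MM => //=; rewrite ltmc_add2l.
apply: bracket_mon => l /= le_lk; apply: ltmc_mdeg.
by rewrite mdegD mdeg1 addn1 ltnS (leq_trans le_lk) // lemc_mdeg // ltW.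
Qed.

(* The leading coefficients at m: the ideals of K[X] attached to the
   filtration of the module by the degree-lexicographic order. *)
Definition lead m (c : {poly K}) := W [set k | (k < m)%O] (adp c z (mon m)).

Lemma leadM m c d : lead m c -> lead m (d * c).
Proof. by rewrite /lead adpM; apply: zspan_adp. Qed.

Lemma leadB m c d : lead m c -> lead m d -> lead m (c - d).
Proof.
have sW := zspan_subspace (mons [set k | (k < m)%O]).
by rewrite /lead -scaleN1r addrC adp_lin => Hc Hd; apply: sW.2.
Qed.

(** Apply ad e_j to c(ad z) [mon m]. It commutes with c(ad z) modulo Q, keeps the filtration, and
    carries [mon m] to [mon (m + U_(j))] up to lower degree. *)
Lemma lead_add1 (j : 'I_n) m c : lead m c -> lead (m + U_(j))%MM c.
Proof.
move=> mc; have sW := zspan_subspace (mons [set k | (k < (m + U_(j))%MM)%O]).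
have Hj : W [set k | (k < (m + U_(j))%MM)%O] (adp c z ⁅e`_j, mon m⁆).
  rewrite -[adp _ _ _](subKr ⁅e`_j, adp c z (mon m)⁆).
  apply: (subspaceB sW); first exact: bracket_Wlt.
  by apply: subQ_zspan; apply: (adp_comm _ iP iQ) => [x|]; [apply: zC | apply: actP].
rewrite /lead -[mon _](subKr ⁅e`_j, mon m⁆) adpBr; apply: (subspaceB sW) => //.
apply: zspan_adp; apply: bracket_mon => l /= le_lm.
by apply: ltmc_mdeg; rewrite mdegD mdeg1 addn1 ltnS.
Qed.

Lemma lead_mono m k c : (m <= k)%MM -> lead m c -> lead k c.
Proof.
move=> le_mk mc; rewrite -(submK le_mk) addmC; move: (k - m)%MM => {le_mk}k.
have [d le_kd] := ubnP (mdeg k); elim: d k le_kd => // d IH k le_kd.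
have [|] := boolP (mdeg k == 0%N); first by rewrite mdeg_eq0 => /eqP->; rewrite addm0.
rewrite mdegE sum_nat_eq0 negb_forall => /existsP[i]; rewrite /= -lep1mP => le_ik.
rewrite -(submK le_ik) addmA; apply: lead_add1; apply: IH.
by move: le_kd; rewrite -{1}(submK le_ik) mdegD mdeg1 addn1 ltnS.
Qed.

(** [f] is the product of one nonzero leading coefficient at each of the finitely many Dickson
    monomials; every m with a nonzero one lies above one of these and inherits its coefficient. *)
Lemma lead_common : exists2 f : {poly K}, f != 0 &
  forall m, (exists2 c, c != 0 & lead m c) -> lead m f.
Proof.
have [s [sD sP]] := mnm_dickson [set m | exists2 c, c != 0 & lead m c].
have /choice[c cP] m : exists c : {poly K}, m \in s -> c != 0 /\ lead m c.
  have [/sD[c c0 mc]|_] := boolP (m \in s); first by exists c.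
  by exists 0.
exists (\prod_(m <- s) c m).
  by rewrite prodf_seq_neq0; apply/allP => m /cP[].
move=> m /sP[k ks le_km]; apply: (lead_mono le_km).
rewrite (big_rem _ ks) /= mulrC; apply: leadM.
by have [] := cP k ks.
Qed.

(** * The filtration by leading monomials *)

Definition monle m : set A := W [set k | (k <= m)%O].

(** The order is total, so the monomials that occur have a largest one; if none occurs, u lies in
    Q. *)
Lemma zspan_mons_cases D u : W D u -> Q u \/ exists2 m, D m & monle m u.
Proof.
move: u; apply: (@zspan_sub _ [set u | Q u \/ exists2 m, D m & monle m u]); last first.
  by move=> _ [m Dm <-]; right; exists m => //; apply: sub_zspan; exists m => //=.
have sW m := zspan_subspace (mons [set k | (k <= m)%O]).
have leS m k : (m <= k)%O -> monle m `<=` monle k.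
  by move=> le_mk; apply: monsS => l /= /le_trans; apply.
split=> [|x|x [Qx|[m Dm mx]]]; last 3 first.
- by left.
- by left; apply: ideal_bracketr.
- by right; exists m => //; case: (zspan_zsub (mons [set k | (k <= m)%O])) => _ _; apply.
split=> [|k x y]; first by left; apply: ideal0.
move=> [Qx|[m Dm mx]] [Qy|[l Dl ly]]; first by left; apply: iQ.1.2.
- by right; exists l => //; apply: (sW l).2 => //; apply: subQ_zspan.
- by right; exists m => //; apply: (sW m).2 => //; apply: subQ_zspan.
right; case: (leP m l) => [/leS le_ml|/ltW/leS le_lm].
  by exists l => //; apply: (sW l).2 => //; apply: le_ml.
by exists m => //; apply: (sW m).2 => //; apply: le_lm.
Qed.

Lemma monle_dec m u : monle m u ->
  exists c, W [set k | (k < m)%O] (u - adp c z (mon m)).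
Proof.
move=> mu; apply: zspan_dec; apply: zspanS mu => _ [k /= le_km <-].
by move: le_km; rewrite le_eqVlt => /orP[/eqP->|lt_km]; [right | left; exists k].
Qed.

Lemma gen_sub_mons : ideal_gen (Q `|` [set v]) `<=` W setT.
Proof.
have [sW QW Wz] := zspan_zsub (mons setT).
apply: ideal_genU_sub => // [|x ->]; last first.
  apply: sub_zspan; exists 0%MM => //; rewrite /mon; suff -> : word 0 = [::] by [].
  by apply/size0nil; rewrite size_word mdeg0.
split=> // a u; move: a u; apply: bracket_gen => //.
  by apply: zspan_sub zsub_P _; apply: monsP.
move=> j; apply: bracket_zspan; [exact: monsP | exact: zspan_zsub|].
move=> _ [m _ <-]; apply: (subspace_cong sW); last by apply: sub_zspan; exists (m + U_(j))%MM.
exact: bracket_mon.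
Qed.

(** Lower the leading monomial m of u until it lies in D. For m outside D, write u as c [mon m] plus
    lower terms; then (1 + pf)c leads at m. If c is nonzero, so is this product, hence f leads at m,
    and so does c = (1 + pf)c - (pc)f. So u is a combination of smaller monomials. *)
Lemma mons_torsion_free (f p : {poly K}) (D : set 'X_{1..n}) u :
  (forall m, (exists2 c, c != 0 & lead m c) -> lead m f) ->
  1 + p * f != 0 ->
  (forall m k, D m -> (k <= m)%O -> D k) ->
  W setT u -> W D (adp (1 + p * f) z u) -> W D u.
Proof.
move=> fP h0 Ddown /zspan_mons_cases[Qu _|[m _]]; first exact: subQ_zspan.
have sW D' := zspan_subspace (mons D').
elim/(ltmwf (n := n)): m u => m IH u mu hu.
have [Dm|nDm] := pselect (D m); first by apply: monsS mu => k /= /(Ddown _ _ Dm).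
have DW : D `<=` [set k | (k < m)%O].
  by move=> k Dk /=; rewrite ltNge; apply/negP => /(Ddown _ _ Dk).
have [c uc] := monle_dec mu.
suff mc : lead m c.
  have /zspan_mons_cases[Qu|[k /= lt_km ku]] : W [set k | (k < m)%O] u.
  - exact: subspace_cong uc mc.
  - exact: subQ_zspan.
  - exact: IH lt_km _ ku hu.
have [->|c0] := eqVneq c 0; first by rewrite /lead adp0; case: (sW [set k | (k < m)%O]).
have mhc : lead m ((1 + p * f) * c).
  rewrite /lead adpM -[adp c z _](subKr u) adpBr; apply: (subspaceB (sW _)).
    exact: monsS hu.
  exact: zspan_adp.
have -> : c = (1 + p * f) * c - (p * c) * f by rewrite mulrDl mul1r mulrAC addrK.
apply: leadB => //; apply: leadM; apply: fP; exists ((1 + p * f) * c) => //.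
by rewrite mulf_neq0.
Qed.

(** Asking only that h be 1 modulo [f] lets a product of such [f] serve several generators at once.
    Injectivity is [mons_torsion_free] for empty D. Divisibility by the nonunit h makes [f] lead at
    every monomial, so powers of [f] kill the module. *)
Lemma cyclic_torsion : exists2 f : {poly K}, f != 0 &
  forall h : {poly K}, (1 < size h)%N -> f %| h - 1 ->
  (forall u, ideal_gen (Q `|` [set v]) u -> Q (adp h z u) -> Q u) /\
  ((forall u, ideal_gen (Q `|` [set v]) u ->
      exists2 u', ideal_gen (Q `|` [set v]) u' & Q (adp h z u' - u)) ->
   exists k, Q (adp (f ^+ k) z v)).
Proof.
have [f f0 fP] := lead_common; exists f => // h sz_h /dvdpP[p ph].
have hE : h = 1 + p * f by rewrite -ph addrC subrK.
move: sz_h; rewrite {ph}hE => sz_h.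
have h0 : 1 + p * f != 0 by rewrite -size_poly_gt0 (ltn_trans _ sz_h).
have W0 : W set0 `<=` Q.
  apply: zspan_sub => [|_ [m []]].
  by split=> // [|x]; [exact: idealS | exact: ideal_bracketr].
split=> [u /gen_sub_mons Wu hu|hM].
  by apply: W0; apply: mons_torsion_free fP h0 _ Wu _ => //; apply: subQ_zspan.
have leadf m : lead m f.
  have genm : ideal_gen (Q `|` [set v]) (mon m).
    rewrite /mon; elim: (word m) => [|j w IH] /=; first by apply: sub_ideal_gen; right.
    exact: ideal_bracketr (ideal_gen_ideal _) IH.
  have [u /gen_sub_mons Wu hu] := hM _ genm.
  have sW D' := zspan_subspace (mons D').
  (* Since hu is [mon m] modulo Q, torsion-freeness modulo the monomials up to m bounds u by m. *)
  have /monle_dec[c uc] : monle m u.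
    apply: mons_torsion_free fP h0 _ Wu _ => [k l /= le_km le_lk|].
      exact: le_trans le_km.
    apply: (@subspace_cong _ _ _ _ (mon m) (sW _)); first exact: subQ_zspan.
    by apply: sub_zspan; exists m => /=.
  (* Comparing [mon m] = hu with u = c [mon m] + lower terms, 1 - hc leads at m; it is nonzero
     because h is not constant. *)
  apply: fP; exists (1 - (1 + p * f) * c).
    rewrite subr_eq0 eq_sym; apply/negP => /eqP hc1.
    have := congr1 (fun q : {poly K} => size q) hc1.
    rewrite size_poly1 => /eqP; rewrite size_mul_eq1 => /andP[/eqP sz1 _].
    by rewrite sz1 in sz_h.
  rewrite /lead -scaleN1r addrC adp_lin adp1 scaleN1r adpM addrC.
  rewrite -opprB; apply: (subspaceN (sW _)).
  rewrite -(subrKA (adp (1 + p * f) z u)); apply: (subspaceD (sW _)).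
    rewrite -opprB -adpBr; apply: (subspaceN (sW _)).
    exact: zspan_adp uc.
  exact: subQ_zspan.
have tors D : (forall m, D m -> exists k, Q (adp (f ^+ k) z (mon m))) ->
    W D `<=` [set u | exists k, Q (adp (f ^+ k) z u)].
  move=> HD; apply: zspan_sub => [|_ [m Dm <-]]; last exact: HD.
  split=> [|x Qx|x [k Hk]]; last 2 first.
  - by exists 0%N; rewrite expr0 adp1.
  - by exists k; rewrite adp_bracket; apply: ideal_bracketr.
  split=> [|l x y [k Hk] [k' Hk']]; first by exists 0%N; rewrite adp0r; exact: ideal0.
  exists (k + k')%N; rewrite adp_linr; apply: iQ.1.2.
    by rewrite exprD mulrC adpM; apply: adp_ideal.
  by rewrite exprD adpM; apply: adp_ideal.
suff monQ m : exists k, Q (adp (f ^+ k) z (mon m)).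
  apply: (tors setT) => //; apply: gen_sub_mons.
  by apply: sub_ideal_gen; right.
(* [f] carries [mon m] into the span of smaller monomials, each killed by a power of [f]. *)
elim/(ltmwf (n := n)): m => m IH.
have [k Hk] := tors _ (fun k lt_km => IH k lt_km) _ (leadf m).
by exists k.+1; rewrite exprSr adpM.
Qed.

End CyclicModule.

(** * Finitely generated modules *)

Section FinitelyGeneratedModule.
Context {K : fieldType} {A : lieAlgType K}.
Implicit Types (J P Q : set A) (e : seq A) (z : A).

Definition ad_divisible z P Q := forall g : {poly K}, g`_0 != 0 ->
  forall y, P y -> exists2 x, P x & Q (adp g z x - y).

(** The kernel of p(ad z) on P/Q is a submodule, as ad z commutes with the action of A; so
    generators decide. *)
Lemma adp_ideal_gen P Q z (p : {poly K}) (G : set A) : is_ideal P -> is_ideal Q ->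
  Q `<=` P -> G `<=` P -> (forall a x, P x -> Q ⁅⁅a, z⁆, x⁆) ->
  (forall u, G u -> Q (adp p z u)) ->
  forall u, ideal_gen (Q `|` G) u -> Q (adp p z u).
Proof.
move=> iP iQ QP GP zC HG u Gu; suff [] : P u /\ Q (adp p z u) by [].
move: u Gu; apply: (@ideal_gen_sub _ _ _ [set u | P u /\ Q (adp p z u)]) => [|u [Qu|Gu]].
- split=> [|a u [Pu Qu]].
    split=> [|k x y [Px Qx] [Py Qy]]; first by rewrite /= adp0r; split; apply: ideal0.
    by rewrite /= adp_linr; split; [apply: iP.1.2 | apply: iQ.1.2].
  split; first exact: ideal_bracketr.
  rewrite -[adp _ _ _](subKr ⁅a, adp p z u⁆); apply: (subspaceB iQ.1).
    exact: ideal_bracketr.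
  by apply: (adp_comm _ iP iQ) => // x; apply: zC.
- by split; [apply: QP | apply: adp_ideal].
- by split; [apply: GP | apply: HG].
Qed.

(** Induction on the generators: [Q'] comes from the tail, and M/Q' is cyclic. Surjectivity of h on
    M/Q passes to M/Q', and to Q'/Q because h is injective on M/Q'. *)
Lemma fg_torsion J P e z (vs : seq A) : is_ideal P ->
  (forall a, lspan ([set` e] `|` J) a) -> [set` vs] `<=` P ->
  forall Q, is_ideal Q -> Q `<=` P ->
  (forall a x, J a -> P x -> Q ⁅a, x⁆) ->
  (forall a x, P x -> Q ⁅⁅a, z⁆, x⁆) ->
  exists2 f : {poly K}, f != 0 & forall h : {poly K}, (1 < size h)%N -> f %| h - 1 ->
  let M := ideal_gen (Q `|` [set` vs]) in
  (forall u, M u -> Q (adp h z u) -> Q u) /\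
  ((forall u, M u -> exists2 u', M u' & Q (adp h z u' - u)) ->
   exists k, forall u, M u -> Q (adp (f ^+ k) z u)).
Proof.
move=> iP eT; elim: vs => [|v vs IH] vsP Q iQ QP JP zC.
  have MQ : ideal_gen (Q `|` [set` [::]]) `<=` Q by apply: ideal_genU_sub.
  exists 1; first exact: oner_neq0.
  move=> p _ _ M; split=> [u /MQ//|_]; exists 0%N => u /MQ.
  by rewrite expr0 adp1.
have vsP' : [set` vs] `<=` P by move=> x xs; apply: vsP; rewrite /= inE xs orbT.
have [f2 f20 f2P] := IH vsP' Q iQ QP JP zC.
pose Q' := ideal_gen (Q `|` [set` vs]).
have iQ' : is_ideal Q' := ideal_gen_ideal _.
have QQ' : Q `<=` Q' by move=> x Qx; apply: sub_ideal_gen; left.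
have Q'P : Q' `<=` P by apply: ideal_genU_sub.
have Pv : P v by apply: vsP; rewrite /= mem_head.
have zC' a x : P x -> Q' ⁅⁅a, z⁆, x⁆ by move=> Px; apply: QQ'; apply: zC.
have [f1 f10 f1P] := @cyclic_torsion K A J P Q' e z v iP iQ' Q'P eT
  (fun a x Ja Px => QQ' _ (JP a x Ja Px)) zC' Pv.
exists (f1 * f2); first by rewrite mulf_neq0.
move=> h sz_h f12h M.
have iM : is_ideal M := ideal_gen_ideal _.
have Q'M : Q' `<=` M.
  by apply: ideal_genS => x [|/= xs]; [left | right; rewrite /= inE xs orbT].
have MQ'v : M `<=` ideal_gen (Q' `|` [set v]).
  apply: ideal_genU_sub; first exact: ideal_gen_ideal.
    by move=> x Qx; apply: sub_ideal_gen; left; apply: QQ'.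
  move=> x; rewrite /= inE => /orP[/eqP->|xs]; apply: sub_ideal_gen; first by right.
  by left; apply: sub_ideal_gen; right.
have Q'vM : ideal_gen (Q' `|` [set v]) `<=` M.
  apply: ideal_genU_sub => // x ->; apply: sub_ideal_gen; right.
  by rewrite /= mem_head.
have [tf1 dv1] := f1P h sz_h (dvdp_trans (dvdp_mulr _ (dvdpp _)) f12h).
have [tf2 dv2] := f2P h sz_h (dvdp_trans (dvdp_mull _ (dvdpp _)) f12h).
have tfM u : M u -> Q (adp h z u) -> Q' u.
  by move=> /MQ'v Mu /QQ'; apply: tf1.
split=> [u Mu hu|Mdiv]; first by apply: tf2 => //; apply: tfM hu.
have [u /Q'vM Mu|k1 Hk1] := dv1.
  by have [u' /MQ'v Mu' hu'] := Mdiv u Mu; exists u' => //; apply: QQ'.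
have [u Q'u|k2 Hk2] := dv2.
  have [u' Mu' hu'] := Mdiv u (Q'M _ Q'u); exists u' => //.
  apply: tf1; first exact: MQ'v.
  by apply: (@subspace_cong _ _ _ _ u iQ'.1) => //; apply: QQ'.
exists (k1 + k2)%N => u /MQ'v Mu.
have Q'k1 : Q' (adp (f1 ^+ k1) z u).
  by refine (adp_ideal_gen iP iQ' Q'P _ zC' _ Mu) => [w|w] ->.
(* The right factor takes M through [Q'] into Q; the left one is the surplus of the common
   exponent. *)
have -> : (f1 * f2) ^+ (k1 + k2) = (f1 ^+ k2 * f2 ^+ k1) * (f2 ^+ k2 * f1 ^+ k1).
  rewrite exprMn !exprD (mulrC (f1 ^+ k1) (f1 ^+ k2)) -!mulrA; congr (_ * _).
  by rewrite mulrC mulrA.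
by rewrite adpM; apply: adp_ideal => //; rewrite adpM; apply: Hk2.
Qed.

Lemma ad_nilpotent J P Q e z (vs : seq A) : is_ideal P -> is_ideal Q -> Q `<=` P ->
  (forall a, lspan ([set` e] `|` J) a) -> [set` vs] `<=` P ->
  P `<=` ideal_gen (Q `|` [set` vs]) ->
  (forall a x, J a -> P x -> Q ⁅a, x⁆) ->
  (forall a x, P x -> Q ⁅⁅a, z⁆, x⁆) ->
  ad_divisible z P Q -> exists k, forall u, P u -> Q (adp 'X^k z u).
Proof.
move=> iP iQ QP eT vsP PM JP zC zdiv.
have MP : ideal_gen (Q `|` [set` vs]) `<=` P by apply: ideal_genU_sub.
have [f f0 fP] := fg_torsion iP eT vsP iQ QP JP zC.
(* The factor X gives h(0) = 1, so that [zdiv] applies, and makes h nonconstant. *)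
pose h := f * 'X + 1%:P.
have sz_h : (1 < size h)%N by rewrite size_MXaddC (negPf f0) ltnS size_poly_gt0.
have [|_ [u /MP Pu|k Hk]] := fP h sz_h; first by rewrite /h addrK dvdp_mulr.
  have [|u' Pu' hu'] := zdiv h _ u Pu; last by exists u' => //; apply: PM.
  by rewrite coefD coefMX coefC add0r oner_neq0.
(* Split off the root 0: f^k = g X^a with g(0) nonzero. If u = g(ad z) x modulo Q, then X^a sends u
   to the image of x under f^k, which is 0 modulo Q. *)
have [a [g]] := multiplicity_XsubC (f ^+ k) 0.
rewrite expf_neq0 // subr0 rootE horner_coef0 /= => g0 fkE.
exists a => u Pu; have [x Px gx] := zdiv g g0 u Pu.
rewrite -[u](subKr (adp g z x)) adpBr -adpM [_ * g]mulrC -fkE.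
by apply: (subspaceB iQ.1); [apply: Hk; apply: PM | apply: adp_ideal].
Qed.

(* P/Q is a finitely generated module on which J and s act trivially and on which
   g(ad z) is onto for z in e and g(0) <> 0. *)
Record graded_hyp J P Q e s : Prop := GradedHyp {
  gh_P : is_ideal P;
  gh_Q : is_ideal Q;
  gh_QP : Q `<=` P;
  gh_J : forall a x, J a -> P x -> Q ⁅a, x⁆;
  gh_s : forall a x, a \in (s : seq A) -> P x -> Q ⁅a, x⁆;
  gh_fg : exists2 vs : seq A, [set` vs] `<=` P & P `<=` ideal_gen (Q `|` [set` vs]);
  gh_div : forall z, z \in e -> ad_divisible z P Q
}.

Lemma graded_hyp_bracket J P Q e s : graded_hyp J P Q e s ->
  forall a, lspan ([set` s] `|` J) a -> forall x, P x -> Q ⁅a, x⁆.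
Proof.
move=> [iP iQ QP JP sP _ _].
apply: (@lspan_sub _ _ _ [set a | forall x, P x -> Q ⁅a, x⁆]) => [|a [|]].
- split=> [x _|k a b Ha Hb x Px]; first by rewrite bracket0l; apply: ideal0.
  by rewrite bracketPl; apply: iQ.1.2; [apply: Ha|apply: Hb].
- by move=> /= sa x; apply: sP.
- by move=> Ja x; apply: JP.
Qed.

(** d counts the entries of [e] not yet known to act trivially. The next one, z, is central modulo
    those before it, so [ad_nilpotent] applies; an inner induction on the exponent n of ad z reduces
    to trivial action of z. *)
Lemma graded_nilpotent J e :
  (forall a, lspan ([set` e] `|` J) a) ->
  (forall i a, (i < size e)%N -> lspan ([set` take i e] `|` J) ⁅a, e`_i⁆) ->
  forall d i P Q, (i + d)%N = size e -> graded_hyp J P Q e (take i e) ->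
  exists k, desc k P `<=` Q.
Proof.
move=> eT echain; elim=> [|d IH] i P Q.
  rewrite addn0 => -> H; rewrite take_size in H; exists 1%N.
  apply: comm_sub; first exact: (gh_Q H).1.
  by move=> a x _; apply: (graded_hyp_bracket H).
move=> id_e H; have lt_ie : (i < size e)%N by rewrite -id_e addnS ltnS leq_addr.
set z := e`_i; have ze : z \in e by apply: mem_nth.
have zC P' : graded_hyp J P' Q e (take i e) -> forall a x, P' x -> Q ⁅⁅a, z⁆, x⁆.
  by move=> H' a x; apply: (graded_hyp_bracket H'); apply: echain.
have [vs vsP PM] := gh_fg H.
have [n] := ad_nilpotent (gh_P H) (gh_Q H) (gh_QP H) eT vsP PM (gh_J H) (zC P H)
  (gh_div H ze).
elim: n P H {vs vsP PM} => [|n IHn] P H nP.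
  by exists 0%N => u /nP; rewrite expr0 adp1.
have [iP iQ QP JP sP [vs vsP PM] Pdiv] := H.
have zCP := zC P H.
(* Both P/P1 and P1/Q inherit the hypotheses; z acts trivially on the first,
   and a smaller power of ad z kills the second. *)
pose P1 : set A := [set u | exists2 p, P p & Q (u - ⁅z, p⁆)].
have P1z p : P p -> P1 ⁅z, p⁆ by exists p => //; rewrite subrr; apply: ideal0.
have QP1 : Q `<=` P1.
  by move=> x Qx; exists 0; [apply: ideal0 | rewrite bracket0r subr0].
have P1P : P1 `<=` P.
  move=> u [p Pp up]; apply: (subspace_cong iP.1 (QP _ up)).
  exact: ideal_bracketr.
have iP1 : is_ideal P1.
  split=> [|a u [p Pp up]].
    split=> [|k u v [p Pp up] [q Pq vq]]; first exact: (QP1 _ (ideal0 iQ)).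
    exists (k *: p + q); first exact: iP.1.2.
    by rewrite bracketPr opprD addrACA -scalerBr; apply: iQ.1.2.
  exists ⁅a, p⁆; first exact: ideal_bracketr.
  apply: (@subspace_cong _ _ _ _ ⁅a, u - ⁅z, p⁆⁆ iQ.1).
    rewrite bracketBr opprB (bracket_leibniz a z p) addrC addrA subrK addrK.
    exact: zCP.
  exact: ideal_bracketr.
have H1 : graded_hyp J P1 Q e (take i e).
  split=> //; first by move=> a x Ja /P1P; apply: JP.
  - by move=> a x sa /P1P; apply: sP.
  (* ad z is an A-linear map from P/Q onto P1/Q, so the images of generators generate. *)
  - exists [seq ⁅z, w⁆ | w <- vs].
      by move=> _ /mapP[w ws ->]; apply: P1z; apply: vsP.
    set R := ideal_gen _; have iR : is_ideal R := ideal_gen_ideal _.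
    have QR : Q `<=` R by move=> x Qx; apply: sub_ideal_gen; left.
    have PR : P `<=` [set p | P p /\ R ⁅z, p⁆].
      apply: subset_trans PM _; apply: ideal_genU_sub => [|x Qx|x xs].
      + split=> [|a u [Pu Ru]].
          split=> [|k x y [Px Rx] [Py Ry]].
            by split; [apply: ideal0 | rewrite bracket0r; apply: ideal0].
          by split; [apply: iP.1.2 | rewrite bracketPr; apply: iR.1.2].
        split; first exact: ideal_bracketr.
        rewrite bracket_leibniz; apply: (subspaceD iR.1); last by apply: ideal_bracketr iR Ru.
        by rewrite (bracketC z) bracketNl; apply: (subspaceN iR.1); apply: QR; apply: zCP.
      + by split; [apply: QP | apply: QR; apply: ideal_bracketr].
      + split; first exact: vsP.
        by apply: sub_ideal_gen; right; apply: map_f.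
    move=> u [p /PR[_ Rzp] /QR up]; exact: subspace_cong iR.1 up Rzp.
  (* Solve for the preimage p and apply ad z, which commutes with g(ad x) on P/Q. *)
  - move=> x xe g g0 y [p Pp yp]; have [x' Px' gx'] := Pdiv x xe g g0 p Pp.
    exists ⁅z, x'⁆; first exact: P1z.
    apply: (@subspace_cong _ _ _ _ (⁅z, adp g x x'⁆ - y) iQ.1); last first.
      rewrite -(subrKA ⁅z, p⁆) -bracketBr; apply: (subspaceD iQ.1).
        exact: ideal_bracketr.
      by rewrite -opprB; apply: (subspaceN iQ.1).
    rewrite opprB addrA subrK -opprB; apply: (subspaceN iQ.1).
    apply: (adp_comm _ iP iQ) => // w Pw.
    by rewrite (bracketC z) bracketNl; apply: (subspaceN iQ.1); apply: zCP.
have H2 : graded_hyp J P P1 e (take i.+1 e).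
  split=> //; first by move=> a x Ja Px; apply: QP1; apply: JP.
  - move=> a x; rewrite (take_nth 0 lt_ie) mem_rcons inE => /orP[/eqP->|sa] Px.
      exact: P1z.
    by apply: QP1; apply: sP.
  - exists vs => //; apply: subset_trans PM _; apply: ideal_genU_sub => [|x Qx|x xs].
    + exact: ideal_gen_ideal.
    + by apply: sub_ideal_gen; left; apply: QP1.
    + by apply: sub_ideal_gen; right.
  - move=> x xe g g0 y Py; have [x' Px' gx'] := Pdiv x xe g g0 y Py.
    by exists x' => //; apply: QP1.
have [k1 k1P] := IH _ _ _ (etrans (addSnnS i d) id_e) H2.
(* P1 is ⁅z, P⁆ + Q, so the exponent drops by one on P1/Q. *)
have [u [p Pp up]|k2 k2P] := IHn P1 H1.
  rewrite -[u](subrK ⁅z, p⁆) adpDr; apply: (subspaceD iQ.1); first exact: adp_ideal.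
  by rewrite adp_bracket -adpMX -exprSr; apply: nP.
by exists (k2 + k1)%N; apply: desc_trans k1P k2P.
Qed.
End FinitelyGeneratedModule.

(** * Finitely generated nilpotent quotients *)

Section FiniteSpans.
Context {K : fieldType} {A : lieAlgType K}.
Implicit Types (M N : set A) (G e s : seq A).

Lemma lspan_finite G M x : lspan ([set` G] `|` M) x ->
  exists2 V : seq A, [set` V] `<=` M & lspan ([set` G] `|` [set` V]) x.
Proof.
move: x; apply: (@lspan_sub _ _ _
  [set x | exists2 V : seq A, [set` V] `<=` M & lspan ([set` G] `|` [set` V]) x]).
  split=> [|k x y [V VM Vx] [V' VM' Vy]].
    by exists [::] => //; case: (lspan_subspace ([set` G] `|` [set` [::]])).
  exists (V ++ V').
    by move=> w /=; rewrite mem_cat => /orP[/VM|/VM'].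
  apply: (lspan_subspace _).2; [move: Vx | move: Vy]; apply: lspanS => w [Gw|Vw].
  - by left.
  - by right; rewrite /= mem_cat Vw.
  - by left.
  - by right; rewrite /= mem_cat Vw orbT.
move=> x [Gx|Mx]; first by exists [::] => //; apply: sub_lspan; left.
exists [:: x]; last by apply: sub_lspan; right; rewrite /= mem_head.
by move=> w; rewrite /= inE => /eqP ->.
Qed.

Lemma lspan_finite_seq M (T : seq (A * seq A)) :
  (forall t, t \in T -> lspan ([set` t.2] `|` M) t.1) ->
  exists2 V : seq A, [set` V] `<=` M &
    forall t, t \in T -> lspan ([set` t.2] `|` [set` V]) t.1.
Proof.
elim: T => [|t T IH] TP; first by exists [::].
have [|V VM VP] := IH; first by move=> u uT; apply: TP; rewrite inE uT orbT.
have [V' VM' VP'] := lspan_finite (TP t (mem_head _ _)).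
exists (V ++ V'); first by move=> w /=; rewrite mem_cat => /orP[/VM|/VM'].
move=> u; rewrite inE => /orP[/eqP->|/VP]; [move: VP'|]; apply: lspanS => w [?|Vw].
- by left.
- by right; rewrite /= mem_cat Vw orbT.
- by left.
- by right; rewrite /= mem_cat Vw.
Qed.

Lemma lspan_bracket (G H T : set A) : is_subspace T ->
  (forall x y, G x -> H y -> T ⁅x, y⁆) ->
  forall x y, lspan G x -> lspan H y -> T ⁅x, y⁆.
Proof.
move=> sT GHT x y Gx Hy; move: x Gx.
apply: (@lspan_sub _ _ _ [set x | T ⁅x, y⁆]) => [|x Gx].
  split=> [|k u v Tu Tv]; first by rewrite /= bracket0l; case: sT.
  by rewrite /= bracketPl; apply: sT.2.
move: y Hy; apply: (@lspan_sub _ _ _ [set y | T ⁅x, y⁆]) => [|y Hy]; last exact: GHT.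
split=> [|k u v Tu Tv]; first by rewrite /= bracket0r; case: sT.
by rewrite /= bracketPr; apply: sT.2.
Qed.

Notation gamma k := (desc k [set: A]).

(** A is spanned by [s] modulo [gamma 1], so the k-th layer is spanned by right-normed brackets of k
    + 1 generators. *)
Lemma lower_central_span s k : smallest is_subalgebra [set` s] = setT ->
  exists2 S : seq A, [set` S] `<=` gamma k &
    gamma k `<=` lspan ([set` S] `|` gamma k.+1).
Proof.
move=> sT; have sA : setT `<=` lspan ([set` s] `|` gamma 1).
  rewrite -[X in X `<=` _]sT; apply: smallest_sub; last by move=> x sx; apply: sub_lspan; left.
  split; first exact: lspan_subspace.
  by move=> x y _ _; apply: sub_lspan; right; exact: comm_bracket.
elim: k => [|k [S Sk kS]]; first by exists s.
exists [seq ⁅x, y⁆ | x <- s, y <- S].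
  by move=> _ /allpairsP[[x y] [_ /Sk Sy ->]]; apply: comm_bracket.
apply: comm_sub; first exact: lspan_subspace.
move=> x y _ /kS; have := sA x I; move: x y; apply: lspan_bracket; first exact: lspan_subspace.
move=> x y [sx|gx] [Sy|gy]; apply: sub_lspan; last 3 first.
- by right; apply: comm_bracket.
- right; move: x gx; apply: comm_sub.
    split=> [|l u v Hu Hv]; first by rewrite /= bracket0l; case: (comm_subspace setT (gamma k.+1)).
    by rewrite /= bracketPl; apply: (comm_subspace _ _).2.
  (* ⁅⁅a, b⁆, y⁆ is a difference of double brackets of y, so [gamma 1] moves y two layers down. *)
  move=> a b _ _ /=; have /eqP := bracket_leibniz a b y.
  rewrite -subr_eq => /eqP <-; apply: (subspaceB (comm_subspace _ _)).
    by apply: comm_bracket => //; apply: comm_bracket => //; apply: Sk.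
  by apply: comm_bracket => //; apply: comm_bracket => //; apply: Sk.
- by right; apply: comm_bracket.
by left; apply/allpairsP; exists (x, y).
Qed.

Definition central_chain e M :=
  forall i a, (i < size e)%N -> lspan ([set` take i e] `|` M) ⁅a, e`_i⁆.

(** Spanning lists of the layers are concatenated, the deepest first, so a bracket with an entry
    falls into the span of earlier ones. *)
Lemma lower_central_chain s n : smallest is_subalgebra [set` s] = setT ->
  exists2 e : seq A, setT `<=` lspan ([set` e] `|` gamma n) & central_chain e (gamma n).
Proof.
move=> sT.
suff [e] : exists2 e : seq A, gamma (n - n) `<=` lspan ([set` e] `|` gamma n) &
  central_chain e (gamma n) by rewrite subnn; exists e.
have: (n <= n)%N by []; move: {1 4}n => d; elim: d => [_|d IH lt_dn].
  by exists [::] => //; rewrite subn0 => x gx; apply: sub_lspan; right.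
have [e eP ech] := IH (ltnW lt_dn); set k := (n - d.+1)%N.
have kE : (n - d = k.+1)%N by rewrite /k subnSK.
rewrite kE in eP; have [S Sk kS] := lower_central_span k sT.
exists (e ++ S) => [|i a].
  apply: subset_trans kS _; apply: lspan_sub; first exact: lspan_subspace.
  move=> x [Sx|/eP]; first by apply: sub_lspan; left; rewrite /= mem_cat Sx orbT.
  by apply: lspanS => w [ew|]; [left; rewrite /= mem_cat ew | right].
rewrite size_cat nth_cat take_cat; case: (ltnP i (size e)) => [lt_ie _|le_ei lt_i]; first exact: ech.
have : gamma k.+1 ⁅a, S`_(i - size e)⁆.
  by apply: comm_bracket => //; apply: Sk; rewrite /= mem_nth // ltn_subLR.
move/eP; apply: lspanS => w [ew|]; last by right.
by left; rewrite /= mem_cat ew.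
Qed.

(** Finite presentability of the nilpotent quotient: finitely many relations make [e] a spanning
    central chain modulo M. They involve finitely many elements of M, so they persist modulo the
    ideal J generated by N and these, and J/N is finitely generated. *)
Lemma central_chain_ideal s n M N : smallest is_subalgebra [set` s] = setT ->
  is_ideal M -> is_ideal N -> N `<=` M -> gamma n `<=` M ->
  exists e vs : seq A, let J := ideal_gen (N `|` [set` vs]) in
  [/\ J `<=` M, forall a, lspan ([set` e] `|` J) a & central_chain e J].
Proof.
move=> sT iM iN NM nM; have [e eT ech] := lower_central_chain n sT.
have toM (G : seq A) : lspan ([set` G] `|` gamma n) `<=` lspan ([set` G] `|` M).
  by apply: lspanS => w [|/nM]; [left|right].
(* Each pair is an element and the list that spans it modulo M. *)
pose T := [seq (x, e) | x <- s] ++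
  [seq (⁅e`_j, e`_i⁆, take i e) | j <- iota 0 (size e), i <- iota 0 (size e)].
have [t|V VM VP] := @lspan_finite_seq M T.
  rewrite mem_cat => /orP[/mapP[x _ ->]|/allpairsP[[j i] [_]]].
    by apply: toM; apply: eT.
  by rewrite mem_iota /= => lt_ie ->; apply: toM; apply: ech.
exists e, V => J; have iJ : is_ideal J := ideal_gen_ideal _.
have VJ : [set` V] `<=` J by move=> x Vx; apply: sub_ideal_gen; right.
have toJ (G : seq A) : lspan ([set` G] `|` [set` V]) `<=` lspan ([set` G] `|` J).
  by apply: lspanS => w [|/VJ]; [left|right].
have eech i j : (i < size e)%N -> (j < size e)%N ->
    lspan ([set` take i e] `|` J) ⁅e`_j, e`_i⁆.
  move=> lt_i lt_j; apply: toJ; apply: (VP (⁅e`_j, e`_i⁆, take i e)).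
  rewrite mem_cat; apply/orP; right; apply/allpairsP; exists (j, i).
  by rewrite !mem_iota.
(* The span of [e] and J is closed under brackets and contains the generators of A. *)
have JT : forall a, lspan ([set` e] `|` J) a.
  move=> a; have : [set: A] a by []; rewrite -sT; apply: smallest_sub.
    split; first exact: lspan_subspace.
    apply: lspan_bracket; first exact: lspan_subspace.
    move=> x y [ex|Jx] [ey|Jy]; last 3 first.
    - by apply: sub_lspan; right; apply: (ideal_bracketr _ iJ).
    - by apply: sub_lspan; right; apply: (ideal_bracketl _ iJ).
    - by apply: sub_lspan; right; apply: (ideal_bracketr _ iJ).
    have [j lt_j <-] := nthP 0 ex; have [i lt_i <-] := nthP 0 ey.
    move: (eech i j lt_i lt_j); apply: lspanS => w [/mem_take|]; by [left|right].
  move=> x sx; apply: toJ; apply: (VP (x, e)).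
  by rewrite mem_cat; apply/orP; left; apply: map_f.
split=> //; first exact: ideal_genU_sub.
move=> i a lt_i; have := JT a; move: a.
apply: (@lspan_sub _ _ _ [set a | lspan ([set` take i e] `|` J) ⁅a, e`_i⁆]).
  split=> [|k x y Hx Hy]; first by rewrite /= bracket0l; case: (lspan_subspace ([set` take i e] `|` J)).
  by rewrite /= bracketPl; apply: (lspan_subspace _).2.
move=> a [/(nthP 0)[j lt_j <-]|Ja]; first exact: eech.
by apply: sub_lspan; right; apply: (ideal_bracketl _ iJ).
Qed.

End FiniteSpans.

(** * Descent along the derived series *)

Section SolvableSteps.
Context {K : fieldType} {A : lieAlgType K}.
Implicit Types (J M N : set A) (e s : seq A).

Lemma chain_bracket J e : is_ideal J -> central_chain e J ->
  forall m a x, (m < size e)%N -> lspan ([set` take m.+1 e] `|` J) x ->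
  lspan ([set` take m e] `|` J) ⁅a, x⁆.
Proof.
move=> iJ ech m a x lt_m; move: x.
have sB := lspan_subspace ([set` take m e] `|` J).
apply: (@lspan_sub _ _ _ [set x | lspan ([set` take m e] `|` J) ⁅a, x⁆]).
  split=> [|k x y Hx Hy]; first by rewrite /= bracket0r; case: sB.
  by rewrite /= bracketPr; apply: sB.2.
move=> x [|Jx]; last by apply: sub_lspan; right; apply: (ideal_bracketr _ iJ).
rewrite /= (take_nth 0 lt_m) mem_rcons inE => /orP[/eqP->|]; first exact: ech.
move=> /(nthP 0)[i]; rewrite size_takel ?(ltnW lt_m) // => lt_im <-; rewrite nth_take //.
have lt_ie := ltn_trans lt_im lt_m.
move: (ech i a lt_ie); apply: lspanS => w [|]; last by right.
by rewrite -(take_takel _ (ltnW lt_im)) => /mem_take; left.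
Qed.

Lemma chain_desc J e : is_ideal J -> (forall a, lspan ([set` e] `|` J) a) ->
  central_chain e J -> desc (size e) setT `<=` J.
Proof.
move=> iJ eT ech.
have H k : (k <= size e)%N ->
    desc k setT `<=` lspan ([set` take (size e - k) e] `|` J).
  elim: k => [_ a _|k IH lt_k]; first by rewrite subn0 take_size.
  apply: comm_sub; first exact: lspan_subspace.
  move=> a x _ /(IH (ltnW lt_k)); rewrite -subnSK //; apply: chain_bracket => //.
  by rewrite ltn_subrL /= (leq_ltn_trans _ lt_k).
move=> a /(H _ (leqnn _)); rewrite subnn take0; move: a.
by apply: lspan_sub; [exact: iJ.1 | move=> a []].
Qed.

(** ad z is nilpotent on A/J. Writing g = pX + c, the element c x is g(ad z) x minus ⁅z, p(ad z) x⁆,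
    which lies one stage lower in the chain than x; so x descends to J. *)
Lemma chain_adp_mem J e (g : {poly K}) z x : is_ideal J ->
  (forall a, lspan ([set` e] `|` J) a) -> central_chain e J ->
  g`_0 != 0 -> J (adp g z x) -> J x.
Proof.
move=> iJ eT ech; elim/poly_ind: g => [|p c _]; first by rewrite coef0 eqxx.
rewrite coefD coefMX coefC add0r adpD adpMX adpC => c0 Jx.
suff H k : (k <= size e)%N -> lspan ([set` take (size e - k) e] `|` J) x.
  have := H _ (leqnn _); rewrite subnn take0; move: x {H Jx}.
  by apply: lspan_sub; [exact: iJ.1 | move=> a []].
elim: k => [_|k IH lt_k]; first by rewrite subn0 take_size.
set m := (size e - k.+1)%N; have mS : (size e - k = m.+1)%N by rewrite /m subnSK.
have lt_m : (m < size e)%N by rewrite ltn_subrL /= (leq_ltn_trans _ lt_k).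
have {IH} := IH (ltnW lt_k); rewrite mS => Bx.
have sB := lspan_subspace ([set` take m e] `|` J).
have Bsub : lspan ([set` take m e] `|` J) `<=` lspan ([set` take m.+1 e] `|` J).
  apply: lspanS => w [|]; last by right.
  by rewrite -(take_takel _ (leqnSn m)) => /mem_take; left.
have Bpx : lspan ([set` take m.+1 e] `|` J) (adp p z x).
  apply: adp_stable Bx; first exact: lspan_subspace.
  by move=> y By; apply: Bsub; apply: chain_bracket.
rewrite -[x]scale1r -(mulVf c0) -scalerA; apply: (subspaceZ _ sB).
rewrite -(addKr ⁅z, adp p z x⁆ (c *: x)) addrC; apply: (subspaceB sB).
  by apply: sub_lspan; right.
exact: chain_bracket.
Qed.

(** M is replaced by J from [central_chain_ideal]. A/J is nilpotent by [chain_desc], and a solution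
    of g(ad z) x = y with y in J stays in J by [chain_adp_mem], so J/N is divisible and
    [graded_nilpotent] applies. *)
Lemma nilpotent_mod s n M N : smallest is_subalgebra [set` s] = setT ->
  is_ideal M -> is_ideal N -> N `<=` M -> desc n setT `<=` M ->
  (forall x y, M x -> M y -> N ⁅x, y⁆) ->
  (forall (g : {poly K}) (z y : A), g`_0 != 0 -> exists x, adp g z x = y) ->
  exists k, desc k setT `<=` N.
Proof.
move=> sT iM iN NM nM MN solv.
have [e [vs]] := central_chain_ideal sT iM iN NM nM.
set J := ideal_gen _ => -[JM eT ech]; have iJ : is_ideal J := ideal_gen_ideal _.
have NJ : N `<=` J by move=> x Nx; apply: sub_ideal_gen; left.
have [|k kN] := @graded_nilpotent K A J e eT ech (size e) 0 J N erefl.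
  rewrite take0; split=> //; first by move=> a x /JM Ma /JM; apply: MN.
    by exists vs => // x xs; apply: sub_ideal_gen; right.
  move=> z _ g g0 y Jy; have [x xy] := solv g z y g0.
  exists x; last by rewrite xy subrr; apply: ideal0.
  by apply: (chain_adp_mem iJ eT ech g0 (z := z)); rewrite xy.
by exists (k + size e)%N; apply: desc_trans kN; apply: chain_desc.
Qed.

Lemma solvable_nilpotent : finitely_generated A -> solvable_lie A ->
  (forall (g : {poly K}) (z y : A), g`_0 != 0 -> exists x, adp g z x = y) ->
  nilpotent_lie A.
Proof.
move=> [s sT] [d dA] solv.
suff [n nD] : exists n, desc n setT `<=` (derived_series d : set A).
  exists n; rewrite lower_central_desc -dA; apply/seteqP; split=> //.
  by rewrite dA => _ ->; apply: ideal0; apply: desc_ideal.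
elim: d {dA} => [|d [n nD]]; first by exists 0%N.
apply: (nilpotent_mod sT (derived_ideal d) (derived_ideal d.+1) _ nD _ solv).
  exact: comm_subr (derived_ideal d).
by move=> x y; apply: comm_bracket.
Qed.

End SolvableSteps.

(** * Equations *)

Section Equations.
Context {K : fieldType} {A : lieAlgType K}.

Lemma adjoin_unknown_ind (S : set (adjoin_unknown A)) : is_subspace S ->
  (forall x y, S x -> S y -> S ⁅x, y⁆) ->
  (forall a, S (coef a)) -> S unknown -> forall w, S w.
Proof.
move=> sS Sbr Sc Sx; apply: fp_ind; elim=> [a|b|s IHs t IHt|c t IHt|s IHs t IHt].
- exact: Sc.
- have -> : \pi_(free_product A (line K)) (FPinr A b) = (b : K) *: unknown :> adjoin_unknown A.
    by rewrite -(lie_homZ (fp_inr_hom A (line K))) /fp_inr [_ *: _]mulr1.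
  exact: subspaceZ.
- by rewrite -fp_addE; apply: subspaceD.
- by rewrite -fp_scaleE; apply: subspaceZ.
- by rewrite -fp_bracket_pi; apply: Sbr.
Qed.

(** The homomorphism [phi] onto the line that kills A vanishes on the ideal generated by A, but
    takes the value g(0) x here. *)
Lemma nonsingular_adp (g : {poly K}) (z y : A) : g`_0 != 0 ->
  nonsingular (adp g (coef z) unknown - coef y).
Proof.
move=> g0 Iw.
pose phi := @fp_lift K A (line K) (line K) (fun=> 0) idfun.
have c0H : lie_hom (fun _ : A => 0 : line K).
  by split=> [c x y'|x y']; rewrite ?scaler0 ?addr0.
have idH : lie_hom (@idfun (line K)) by split.
have phiH : lie_hom phi by apply: fp_lift_hom.
have : phi (adp g (coef z) unknown - coef y) = 0.
  apply: (ideal_gen_sub (S := [set w | phi w = 0]) _ _ Iw).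
    split=> [|u v phiv]; last by rewrite /= phiH.2.
    split=> [|k u v /= phiu phiv]; first exact: lie_hom0.
    by rewrite phiH.1 phiu phiv scaler0 addr0.
  by move=> _ [a _ <-]; apply: fp_lift_inl.
rewrite lie_homB // (adp_hom phiH) /phi /coef !fp_lift_inl // /unknown fp_lift_inr //.
elim/poly_ind: g g0 {Iw} => [|p c _]; first by rewrite coef0 eqxx.
rewrite coefD coefMX coefC add0r adpD adpMX adpC bracket0l add0r subr0 => c0 /eqP.
by rewrite [_ *: _]mulr1 (negPf c0).
Qed.

Lemma adp_solvable : (forall w : adjoin_unknown A, nonsingular w -> exists a : A, solution w a) ->
  forall (g : {poly K}) (z y : A), g`_0 != 0 -> exists x, adp g z x = y.
Proof.
move=> solv g z y g0; have [a] := solv _ (@nonsingular_adp g z y g0).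
rewrite /solution (lie_homB (eval_at_hom a)) (adp_hom (eval_at_hom a)).
by rewrite !eval_at_coef eval_at_unknown => /eqP; rewrite subr_eq0 => /eqP; exists a.
Qed.

(** * Solving equations by iteration in the nilpotent case *)

Notation I := (ideal_gen (range (@coef K A))).

(** Modulo [I] only multiples of x remain, and their brackets vanish. *)
Lemma adjoin_unknown_dec w : exists c : K, I (w - c *: unknown).
Proof.
have iI : is_ideal I := ideal_gen_ideal _.
move: w; apply: (@adjoin_unknown_ind [set w | exists c : K, I (w - c *: unknown)]).
- split=> [|k x y [c xc] [d yd]].
    by exists 0; rewrite scale0r subr0; apply: ideal0.
  exists (k * c + d); rewrite scalerDl -scalerA opprD addrACA -scalerBr.
  exact: iI.1.2.
- move=> x y [c xc] [d yd]; exists 0; rewrite scale0r subr0.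
  rewrite -(subrK (c *: unknown) x) bracketDl; apply: (subspaceD iI.1).
    exact: (ideal_bracketl _ iI).
  rewrite -(subrK (d *: unknown) y) bracketDr; apply: (subspaceD iI.1).
    exact: (ideal_bracketr _ iI).
  by rewrite bracketZl bracketZr bracketxx !scaler0; apply: ideal0.
- move=> a; exists 0; rewrite scale0r subr0; apply: sub_ideal_gen; by exists a.
- by exists 1; rewrite scale1r subrr; apply: ideal0.
Qed.

Notation gamma k := (desc k [set: A]).

Lemma eval_at_cong n a b w : gamma n (a - b) -> gamma n (eval_at a w - eval_at b w).
Proof.
move=> ab; have iG : is_ideal (gamma n) := desc_ideal n idealT.
have [aH bH] := (eval_at_hom a, eval_at_hom b).
move: w; apply: (@adjoin_unknown_ind [set w | gamma n (eval_at a w - eval_at b w)]).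
- split=> [|k x y xH yH]; first by rewrite /= (lie_hom0 aH) (lie_hom0 bH) subrr; apply: ideal0.
  by rewrite /= aH.1 bH.1 opprD addrACA -scalerBr; apply: iG.1.2.
- move=> x y xH yH; rewrite /= aH.2 bH.2 -(subrKA ⁅eval_at b x, eval_at a y⁆).
  rewrite -bracketBl -bracketBr; apply: (subspaceD iG.1).
    exact: (ideal_bracketl _ iG).
  exact: (ideal_bracketr _ iG).
- by move=> c; rewrite /= !eval_at_coef subrr; apply: ideal0.
- by rewrite /= !eval_at_unknown.
Qed.

(** The difference vanishes on coefficients. For ⁅x, y⁆ with y in the ideal it is ⁅x(a) - x(b),
    y(a)⁆ + ⁅x(b), y(a) - y(b)⁆: the first bracket gains a step from [eval_at_cong], the second has
    gained it by induction. *)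
Lemma eval_at_contract n a b v : I v -> gamma n (a - b) ->
  gamma n.+1 (eval_at a v - eval_at b v).
Proof.
move=> Iv ab; have iG : is_ideal (gamma n.+1) := desc_ideal n.+1 idealT.
have [aH bH] := (eval_at_hom a, eval_at_hom b).
apply: (ideal_gen_sub (S := [set v | gamma n.+1 (eval_at a v - eval_at b v)]) _ _ Iv).
  split=> [|x y /= yH].
    split=> [|k x y xH yH]; first by rewrite /= (lie_hom0 aH) (lie_hom0 bH) subrr; apply: ideal0.
    by rewrite /= aH.1 bH.1 opprD addrACA -scalerBr; apply: iG.1.2.
  rewrite aH.2 bH.2 -(subrKA ⁅eval_at b x, eval_at a y⁆).
  rewrite -bracketBl -bracketBr; apply: (subspaceD iG.1).
    by rewrite bracketC; apply: (subspaceN iG.1); apply: comm_bracket => //; apply: eval_at_cong.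
  exact: (ideal_bracketr _ iG).
by move=> _ [c _ <-]; rewrite /= !eval_at_coef subrr; apply: ideal0.
Qed.

Lemma nilpotent_solution (w : adjoin_unknown A) :
  nilpotent_lie A -> nonsingular w -> exists a : A, solution w a.
Proof.
move=> [n An] nsw; have [c Iv] := adjoin_unknown_dec w.
have c0 : c != 0 by apply: contra_notN nsw => /eqP c0; move: Iv; rewrite c0 scale0r subr0.
(* The fixed points of [F] are the solutions of w. *)
pose F a := - c^-1 *: eval_at a (w - c *: unknown).
have Fstep k : gamma k (F (iter k F 0) - iter k F 0).
  elim: k => [//|k IH]; rewrite /F -scalerBr; apply: (subspaceZ _ (desc_ideal k.+1 idealT).1).
  exact: eval_at_contract.
(* The n-th term of the lower central series is 0, so the n-th iterate is fixed. *)
have := Fstep n; rewrite -lower_central_desc An => /eqP; rewrite subr_eq0.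
set a := iter n F 0 => /eqP Fa; exists a.
move: Fa; rewrite /F /solution (lie_homB (eval_at_hom a)) (lie_homZ (eval_at_hom a)) eval_at_unknown.
rewrite scalerBr scalerA mulNr mulVf // scaleN1r opprK scaleNr => /eqP.
by rewrite -subr_eq0 addrK oppr_eq0 scaler_eq0 invr_eq0 (negPf c0) => /eqP.
Qed.

End Equations.

Theorem theorem3 (K : fieldType) (A : lieAlgType K) :
  finitely_generated A -> solvable_lie A ->
  ((forall w : adjoin_unknown A, nonsingular w -> exists a : A, solution w a)
   <-> nilpotent_lie A).
Proof.
move=> fgA solA; split=> [/adp_solvable|nilA w]; first exact: solvable_nilpotent.
exact: nilpotent_solution.
Qed.
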